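(* Assume Assumption A holds and $m_1=\cdots=m_p=m>1$. Let $\widetilde\mu_{i,j}=m\mu_{i,j}$ (which does not depend on $m$), let $\widetilde\rho(t)$ be the spectral radius of $L\widetilde\mu(t)$, and suppose $\nabla\widetilde\rho(0)=0$ (zero drift). Let $\sigma$ be the symmetric positive-definite matrix such that $\widetilde\rho(t)=1+\frac12t^\intercal\sigma t+o(\|t\|^2)$ as $t\to0$. Then, as $m\to1^+$, the rescaled shape of the sandpile $\sqrt{m-1}\cdot\mathcal C_m$, where $\mathcal C_m=\{\frac{u}{\Gamma_m^{-1}(u)\cdot u}:u\in\mathbb S^{d-1}\}$, converges to the ellipsoid $$\left\{s\in\mathbb R^d : 2s^\intercal\sigma^{-1}s\le1\right\},$$ uniformly in spherical coordinates: $$\sup_{u\in\mathbb S^{d-1}}\left|\frac{\sqrt{m-1}}{\Gamma_m^{-1}(u)\cdot u}-\frac{1}{\sqrt{2u^\intercal\sigma^{-1}u}}\right|\longrightarrow0 ,$$ and consequently the region $\{ru:u\in\mathbb S^{d-1},\,0\le r\le\frac{\sqrt{m-1}}{\Gamma_m^{-1}(u)\cdot u}\}$ converges to this ellipsoid in Hausdorff distance.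
   Context: Setting. $d,p\ge1$ are integers. For $x\in\mathbb Z^d$, $i,j\in\{1,\dots,p\}$ let $c(x,i,j)\ge 0$ (fixed, not depending on $m$), with $0<\sigma_i:=\sum_{(y,j)}c(y,i,j)<\infty$, and let $m_i\ge1$ be leakiness parameters. Put $\mu_{i,j}(x)=\frac{c(x,i,j)}{m_i\sigma_i}$. The killed random walk (KRW) $(X_n)$ on $(\mathbb Z^d\times\{1,\dots,p\})\sqcup\{\mathsf k\}$ jumps from $(x,i)$ to $(y,j)$ with probability $\mu_{i,j}(y-x)$ and from $(x,i)$ to the absorbing cemetery $\mathsf k$ with probability $1-\frac1{m_i}$. Assumption A: (1) $m_i>1$ for at least one $i$; (2) the KRW is irreducible: every $(x,j)$ can be reached from every $(0,i)$ with positive probability in some number $n\ge1$ of steps; (3) it is aperiodic: $\gcd\{n\ge1:\mathbb P_{(x,i)}(X_n=(x,i))>0\}=1$ for all $(x,i)$; (4) $\sum_{x}e^{\gamma\|x\|}\mu_{i,j}(x)<\infty$ for all $i,j$ and all $\gamma>0$. For a matrix $\nu=(\nu_{i,j})$ of measures, $L\nu(t)$ is the $p\times p$ matrix with entries $\sum_{x\in\mathbb Z^d}e^{t\cdot x}\nu_{i,j}(x)$, $t\in\mathbb R^d$. Let $\rho(t)$ be the spectral radius of $L\mu(t)$ (depending on $m$; $\rho=\widetilde\rho/m$), and $\partial\mathcal T=\{t:\rho(t)=1\}$. The map $\Gamma_m:\partial\mathcal T\to\mathbb S^{d-1}$, $\Gamma_m(t)=\nabla\rho(t)/\|\nabla\rho(t)\|$,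 is a homeomorphism (known result), and $\Gamma_m^{-1}(u)\cdot u>0$ for all $u$. The curve $\mathcal C_m$ delimits the limit shape, after scaling by $1/\log N$, of the leaky Abelian sandpile with toppling weights $c$ and leakiness $m$ started with $N\to\infty$ grains at the origin. Under the zero drift hypothesis the expansion defining $\sigma$ (the ''energy matrix''; the covariance matrix of $\widetilde\mu$ if $p=1$) and its positive-definiteness are known. *)

(* Defs.v *)
From mathcomp Require Export all_boot all_order all_algebra.
From mathcomp Require Export all_classical all_reals all_analysis.
From mathcomp Require Export complex.
Export Order.TTheory GRing.Theory Num.Theory numFieldNormedType.Exports.

#[export] Set Implicit Arguments.
#[export] Unset Strict Implicit.
#[export] Unset Printing Implicit Defensive.

Global Open Scope classical_set_scope.
Global Open Scope ring_scope.

(** * Euclidean geometry of ['rV[R]_d]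

    The norm [`|t|] that the library puts on ['rV[R]_d] is the sup norm, so the
    Euclidean norm, sphere and Hausdorff distance are defined separately; the
    topology is the same. *)

Section Euclid.
Context {R : realType} {d : nat}.
Implicit Types (s t u : 'rV[R]_d) (S : 'M[R]_d) (A B : set 'rV[R]_d).

Definition dot s t : R := \sum_i s ord0 i * t ord0 i.

Definition enorm t : R := Num.sqrt (dot t t).

Definition esphere : set 'rV[R]_d := [set u | enorm u = 1].

Definition quad S t : R := dot (t *m S) t.

Definition posdef S : Prop := forall t, t != 0 -> 0 < quad S t.

Definition grad (f : 'rV[R]_d -> R) t : 'rV[R]_d :=
  \row_i 'D_(delta_mx ord0 i) f t.

Definition excess A B : \bar R :=
  ereal_sup [set ereal_inf [set (enorm (a - b))%:E | b in B] | a in A].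

Definition hausdorff_dist A B : \bar R := maxe (excess A B) (excess B A).

Definition polar_region (f : 'rV[R]_d -> R) : set 'rV[R]_d :=
  [set s | exists u r, [/\ esphere u, 0 <= r, r <= f u & s = r *: u]].

Definition ellipsoid S : set 'rV[R]_d := [set s | 2 * quad (invmx S) s <= 1].

End Euclid.

(** * Spectral radius of a real matrix

    Largest modulus of a complex eigenvalue; the set is finite, and nonempty
    for [0 < p]. *)

Definition spectral_radius {R : realType} {p : nat} (A : 'M[R]_p) : R :=
  sup [set Normc.normc z | z in
    [set z : R[i] | eigenvalue (map_mx (real_complex R) A) z]].

(** * Matrices of measures on the lattice

    A measure on Z^d is given by its point masses.  [fine] is harmless when the
    exponential moments are finite. *)

Definition laplace {R : realType} {d p : nat}
    (nu : 'I_p -> 'I_p -> 'rV[int]_d -> R) (t : 'rV[R]_d) : 'M[R]_p :=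
  \matrix_(i, j) fine (\esum_(x in [set: 'rV[int]_d])
    (expR (dot t (map_mx intr x)) * nu i j x)%:E).

Definition is_gcd (A : set nat) (g : nat) : Prop :=
  (forall n, A n -> (g %| n)%N) /\
  (forall k, (forall n, A n -> (k %| n)%N) -> (k %| g)%N).

Section KilledWalk.
Context {R : realType} {d p : nat}.
Variable c : 'rV[int]_d -> 'I_p -> 'I_p -> R.

Definition total_weight (i : 'I_p) : \bar R :=
  \esum_(yj in [set: 'rV[int]_d * 'I_p]) (c yj.1 i yj.2)%:E.

Definition mu (m : 'I_p -> R) (i j : 'I_p) (x : 'rV[int]_d) : R :=
  c x i j / (m i * fine (total_weight i)).

(** [None] is the cemetery. *)
Definition state : Type := option ('rV[int]_d * 'I_p).

Definition krw_step (m : 'I_p -> R) (s s' : state) : R :=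
  match s, s' with
  | Some (x, i), Some (y, j) => mu m i j (y - x)
  | Some (_, i), None => 1 - (m i)^-1
  | None, Some _ => 0
  | None, None => 1
  end.

(** [krw_prob m n s s'] is P_s(X_n = s'). *)
Fixpoint krw_prob (m : 'I_p -> R) (n : nat) (s s' : state) : \bar R :=
  if n is n'.+1 then
    (\esum_(z in [set: state]) ((krw_step m s z)%:E * krw_prob m n' z s'))%E
  else ((s == s')%:R)%:E.

Record assumptionA (m : 'I_p -> R) : Prop := AssumptionA {
  leaky : exists i, 1 < m i;
  irreducible : forall (x : 'rV[int]_d) (i j : 'I_p),
    exists2 n, (1 <= n)%N & (0 < krw_prob m n (Some (0%R, i)) (Some (x, j)))%E;
  aperiodic : forall (x : 'rV[int]_d) (i : 'I_p),
    is_gcd [set n | (1 <= n)%N /\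
                    (0 < krw_prob m n (Some (x, i)) (Some (x, i)))%E] 1;
  exp_moments : forall (i j : 'I_p) (gamma : R), 0 < gamma ->
    (\esum_(x in [set: 'rV[int]_d])
       (expR (gamma * enorm (map_mx intr x : 'rV[R]_d)) * mu m i j x)%:E
     < +oo)%E
}.

Definition rho (m : 'I_p -> R) (t : 'rV[R]_d) : R :=
  spectral_radius (laplace (mu m) t).

Definition bdT (m : 'I_p -> R) : set 'rV[R]_d := [set t | rho m t = 1].

Definition Gamma (m : 'I_p -> R) (t : 'rV[R]_d) : 'rV[R]_d :=
  (enorm (grad (rho m) t))^-1 *: grad (rho m) t.

(** Inverse of the bijection [Gamma m] from [bdT m] onto the sphere; the value
    [0] is taken only outside the image of [bdT m]. *)
Definition Gamma_inv (m : 'I_p -> R) : 'rV[R]_d -> 'rV[R]_d :=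
  'pinv_(fun=> 0) (bdT m) (Gamma m).

Definition limit_curve (m : 'I_p -> R) : set 'rV[R]_d :=
  [set (dot (Gamma_inv m u) u)^-1 *: u | u in esphere].

(** Radius, in the direction [u], of [limit_curve] scaled by [sqrt (m - 1)],
    for the constant leakiness [m]. *)
Definition scaled_radius (m : R) (u : 'rV[R]_d) : R :=
  Num.sqrt (m - 1) / dot (Gamma_inv (fun=> m) u) u.

Lemma scaled_limit_curveE (m : R) :
  [set Num.sqrt (m - 1) *: s | s in limit_curve (fun=> m)] =
  [set scaled_radius m u *: u | u in esphere].
Proof.
apply/seteqP; split => [_ [_ [u Su <-] <-]|_ [u Su <-]].
  by exists u => //; rewrite scalerA.
exists ((dot (Gamma_inv (fun=> m) u) u)^-1 *: u); first by exists u.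
by rewrite scalerA.
Qed.

Definition mu_tilde (i j : 'I_p) (x : 'rV[int]_d) : R :=
  c x i j / fine (total_weight i).

Lemma mu_tildeE (m : R) i j x : m != 0 -> mu_tilde i j x = m * mu (fun=> m) i j x.
Proof. by move=> m0; rewrite /mu_tilde /mu invfM mulrCA mulVKf. Qed.

Definition rho_tilde (t : 'rV[R]_d) : R := spectral_radius (laplace mu_tilde t).

End KilledWalk.

(* Main.v *)
Require Import Defs.
From mathcomp Require Import ring lra.

(** Let [rho] be the spectral radius of the Laplace matrix of [mu_tilde], so that
    [bdT m] is the level set [rho = m].  By Perron-Frobenius theory [rho] is convex and
    differentiable; hence [Gamma m t = u] exactly when [t] maximizes [dot t u] over the
    compact convex set [rho <= m], and [dot (Gamma_inv m u) u] is the support function of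
    that set, whichever preimage [Gamma_inv] selects.  As [m] tends to 1 these sets shrink
    to 0 by convexity, so the expansion of [rho] squeezes them between the ellipsoids
    [(1 +- e) * quad sigma t <= 2 * (m - 1)], whose support functions are
    [sqrt (2 * (m - 1) * quad (invmx sigma) u / (1 +- e))]. *)

(** * Perron-Frobenius theory *)

(** The spectral radius is a supremum of moduli of complex eigenvalues, which shows nothing of its
    dependence on [t]. Positive Perron vectors replace that definition. Pairing with a fixed left
    vector expresses the increment of the eigenvalue through increments of matrix entries, so
    continuity and directional derivatives descend from the entries once the normalized right vector
    is known to vary continuously. Testing with a positive right vector bounds the spectral radius
    from above, whence convexity. The derivatives so obtained are along lines, with no uniformity in
    the direction; convexity supplies the first-order inequalities that find and identify maximizers
    of [dot t u]. In the asymptotics every error is multiplicative, [1 - e] or [1 + e]; it becomes a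
    bound uniform in [u] because the limit radius is bounded on the sphere. *)

Definition irreducible_mx {R : realType} {p : nat} (A : 'M[R]_p.+1) : Prop :=
  forall i j, exists n, 0 < (A ^+ n) i j.

Lemma cvg_sumR {R : realType} {T : Type} (F : set_system T) {FF : Filter F}
    (I : finType) (f : I -> T -> R) (l : I -> R) :
  (forall i, f i x @[x --> F] --> l i) -> \sum_i f i x @[x --> F] --> \sum_i l i.
Proof. by move=> fl; apply: cvg_big => //; exact: add_continuous. Qed.

Lemma continuous_sumR {R : realType} {T : topologicalType}
    (I : finType) (f : I -> T -> R) :
  (forall i, continuous (f i)) -> continuous (fun x => \sum_i f i x).
Proof. by move=> fl; apply: continuous_big => //; exact: add_continuous. Qed.

Lemma mx_subZE {R : realType} {m n} (u x : 'M[R]_(m, n)) r i j :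
  (u - r *: x) i j = u i j - r * x i j.
Proof. by rewrite !mxE. Qed.

Section Perron.
Context {R : realType} {p : nat}.
Implicit Types (A B P : 'M[R]_p.+1) (x y v : 'rV[R]_p.+1) (w z : 'cV[R]_p.+1).

Lemma sum_ge0_eq0 (I : finType) (F : I -> R) :
  (forall i, 0 <= F i) -> \sum_i F i = 0 -> forall i, F i = 0.
Proof.
move=> F0 /eqP; rewrite psumr_eq0 => [/allP h i|i _]; last exact: F0.
by apply/eqP/h; rewrite mem_index_enum.
Qed.

Lemma sum_gt0 (I : finType) (F : I -> R) i :
  (forall j, 0 <= F j) -> 0 < F i -> 0 < \sum_j F j.
Proof.
move=> F0 Fi; rewrite (bigD1 i)//= ltr_wpDr// sumr_ge0// => j _.
Qed.

Lemma le_sum_term (I : finType) (F : I -> R) i :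
  (forall j, 0 <= F j) -> F i <= \sum_j F j.
Proof. by move=> F0; rewrite (bigD1 i)//= ler_wpDr// sumr_ge0. Qed.

Lemma expmx_ge0 A n : (forall i j, 0 <= A i j) -> forall i j, 0 <= (A ^+ n) i j.
Proof.
move=> A0; elim: n => [|n IH] i j; first by rewrite expr0 mxE ler0n.
by rewrite exprS mxE sumr_ge0// => k _; rewrite mulr_ge0.
Qed.

(** A sum of powers of [A], one for each pair of indices, the exponent being chosen to make that
    entry positive; powers of [A] commute with [A]. Multiplying by [P] turns any nonzero nonnegative
    row vector into a positive one. *)
Lemma positive_commuting A : (forall i j, 0 <= A i j) -> irreducible_mx A ->
  exists2 P : 'M[R]_p.+1, forall i j, 0 < P i j & P *m A = A *m P.
Proof.
move=> A0 irrA; pose n i j := projT1 (cid (irrA i j)).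
have nP i j : 0 < (A ^+ n i j) i j by exact: (projT2 (cid (irrA i j))).
exists (\sum_i \sum_j A ^+ n i j) => [i j|].
  rewrite summxE; apply: (@sum_gt0 _ _ i) => [k|].
    by rewrite summxE sumr_ge0// => l _; exact: expmx_ge0.
  by rewrite summxE; apply: (@sum_gt0 _ _ j) => // k; exact: expmx_ge0.
rewrite mulmx_suml mulmx_sumr; apply: eq_bigr => i _.
rewrite mulmx_suml mulmx_sumr; apply: eq_bigr => j _.
by rewrite !mulmxE -exprSr -exprS.
Qed.

Definition simplex : set 'rV[R]_p.+1 :=
  [set x | (forall i, 0 <= x ord0 i) /\ \sum_i x ord0 i = 1].

Lemma simplex_normalize x : (forall i, 0 <= x ord0 i) -> x != 0 ->
  0 < \sum_i x ord0 i /\ simplex ((\sum_i x ord0 i)^-1 *: x).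
Proof.
move=> x0 /rV0Pn [k xk].
have s0 : 0 < \sum_i x ord0 i by apply: (sum_gt0 (i := k)) => //; rewrite lt_def xk/=; exact: x0.
split => //; split => [i|]; first by rewrite mxE mulr_ge0// invr_ge0 ltW.
under eq_bigr do rewrite mxE.
by rewrite -mulr_sumr mulVf// gt_eqF.
Qed.

Lemma continuous_mulmx_coord A k : continuous (fun x => (x *m A) ord0 k).
Proof.
rewrite (_ : (fun y => _) = (fun y => \sum_i y ord0 i * A i k)); last first.
  by apply/funext => y; rewrite mxE.
apply: continuous_sumR => i x.
by apply: continuousM; [exact: coord_continuous|exact: cst_continuous].
Qed.

Lemma simplex_le1 x i : simplex x -> x ord0 i <= 1.
Proof. by move=> [x0 <-]; apply: le_sum_term. Qed.

Lemma simplex_bound A x l : (forall i j, 0 <= A i j) -> simplex x ->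
  (forall k, l * x ord0 k <= (x *m A) ord0 k) -> l <= \sum_k \sum_i A i k.
Proof.
move=> A0 xS h; have [x0 x1] := xS.
rewrite -[l]mulr1 -x1 mulr_sumr ler_sum// => k _.
apply: (le_trans (h k)); rewrite mxE ler_sum// => i _.
by rewrite ler_piMl// simplex_le1.
Qed.

(** Each pair is a vector with a Collatz-Wielandt lower bound that it certifies. Keeping the bound
    as a second component avoids the minimum of the quotients of coordinates, which need not be
    continuous where a coordinate vanishes. *)
Lemma compact_collatz A : (forall i j, 0 <= A i j) ->
  compact [set z : 'rV[R]_p.+1 * R | [/\ simplex z.1, 0 <= z.2 &
    forall k, z.2 * z.1 ord0 k <= (z.1 *m A) ord0 k]].
Proof.
move=> A0; set L := (X in compact X); pose M := \sum_k \sum_i A i k.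
have cK : compact ([set x : 'rV[R]_p.+1 | forall i, `[0, 1]%classic (x ord0 i)]
                   `*` `[0, M]%classic).
  apply: compact_setX; last exact: segment_compact.
  have := @rV_compact R p.+1 (fun=> `[0, 1]%classic) (fun _ => @segment_compact R 0 1).
  exact.
apply: (subclosed_compact _ cK); last first.
  move=> [x l] [/= xS l0 h]; split => /= [i|].
    by rewrite in_itv/= simplex_le1// andbT; have [] := xS.
  by rewrite in_itv/= l0/=; exact: (simplex_bound A0 xS h).
have c1 k : continuous (fun z : 'rV[R]_p.+1 * R => z.1 ord0 k).
  move=> z; apply: (@continuous_comp _ _ _ (@fst 'rV[R]_p.+1 R) (fun x : 'rV[R]_p.+1 => x ord0 k)).
    exact: cvg_fst.
  exact: coord_continuous.
have c2 k : continuous (fun z : 'rV[R]_p.+1 * R => (z.1 *m A) ord0 k).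
  move=> z; apply: (@continuous_comp _ _ _ (@fst 'rV[R]_p.+1 R)
    (fun x : 'rV[R]_p.+1 => (x *m A) ord0 k)).
    exact: cvg_fst.
  exact: continuous_mulmx_coord.
have cs : continuous (snd : 'rV[R]_p.+1 * R -> R) by move=> z; exact: cvg_snd.
have -> : L = (\bigcap_k [set z : 'rV[R]_p.+1 * R | 0 <= z.1 ord0 k]) `&`
    [set z : 'rV[R]_p.+1 * R | \sum_k z.1 ord0 k = 1] `&` [set z | 0 <= z.2] `&`
    \bigcap_k [set z : 'rV[R]_p.+1 * R | 0 <= (z.1 *m A) ord0 k - z.2 * z.1 ord0 k].
  apply/seteqP; split => [z [[x0 x1] l0 h]|z [[[x0 x1] l0] h]].
    by split; [split; [split|]|] => //= k _ /=; rewrite ?subr_ge0.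
  split => //=; first by split => // i; exact: x0.
  by move=> k; rewrite -subr_ge0; apply: h.
have cge (f : 'rV[R]_p.+1 * R -> R) : continuous f -> closed [set z | 0 <= f z].
  by move=> cf; apply: (@closed_comp _ _ f [set y | 0 <= y]) => //; exact: closed_ge.
apply: closedI; [apply: closedI; [apply: closedI|]|].
- by apply: closed_bigI => k _; exact: cge.
- apply: (@closed_comp _ _ (fun z : 'rV[R]_p.+1 * R => \sum_k z.1 ord0 k) [set y | y = 1]).
    by move=> z _; exact: (continuous_sumR c1).
  exact: closed_eq.
- exact: cge.
apply: closed_bigI => k _; apply: cge => z; apply: cvgB; first exact: c2.
by apply: cvgM; [exact: cs|exact: c1].
Qed.

Lemma rV_gt0_neq0 x : (forall k, 0 < x ord0 k) -> x != 0.
Proof. by move=> x0; apply/rV0Pn; exists ord0; rewrite gt_eqF. Qed.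

(* If [r *: x <= x *m A] fails to be an equality at a maximal [r], applying the
   positive commuting matrix makes every inequality strict, so [r] can be increased. *)
Lemma perron_row A : (forall i j, 0 <= A i j) -> irreducible_mx A ->
  exists r v, [/\ 0 <= r, forall k, 0 < v ord0 k, v *m A = r *: v &
    forall x l, x != 0 -> (forall k, 0 <= x ord0 k) ->
      (forall k, l * x ord0 k <= (x *m A) ord0 k) -> l <= r].
Proof.
move=> A0 irrA; have [P P0 PA] := positive_commuting A0 irrA.
set L := [set z : 'rV[R]_p.+1 * R | [/\ simplex z.1, 0 <= z.2 &
    forall k, z.2 * z.1 ord0 k <= (z.1 *m A) ord0 k]].
have L0 : L !=set0.
  have o0 : (const_mx 1 : 'rV[R]_p.+1) != 0 by apply: rV_gt0_neq0 => k; rewrite mxE.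
  have [|_ sS] := simplex_normalize _ o0; first by move=> i; rewrite mxE.
  eexists (_, 0); split; [exact: sS| by [] |] => k /=.
  by rewrite mul0r mxE sumr_ge0// => i _; rewrite mulr_ge0// sS.1.
have [||[x r] /set_mem [/= xS r0 xr] rmax] :=
    @compact_EVT_max _ R (snd : 'rV[R]_p.+1 * R -> R) L L0.
- exact: compact_collatz.
- by apply: continuous_subspaceT => z; exact: cvg_snd.
have {}rmax y l : y != 0 -> (forall k, 0 <= y ord0 k) ->
      (forall k, l * y ord0 k <= (y *m A) ord0 k) -> l <= r.
  move=> y0 yge h; have [l0|l0] := ltP 0 l; last exact: le_trans l0 r0.
  have [s0 yS] := simplex_normalize yge y0.
  apply: (rmax (_, l)); apply/mem_set; split; [exact: yS|exact: (ltW l0)|] => k /=.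
  rewrite -scalemxAl !mxE mulrCA ler_wpM2l ?invr_ge0 ?(ltW s0)//.
  by have := h k; rewrite mxE.
have gt0P y : (forall k, 0 <= y ord0 k) -> y != 0 -> forall k, 0 < (y *m P) ord0 k.
  move=> y0 /rV0Pn [i yi] k; rewrite mxE; apply: (sum_gt0 (i := i)) => [j|].
    by rewrite mulr_ge0// ltW.
  by rewrite mulr_gt0// lt_def yi y0.
have x0 : x != 0.
  apply/eqP => x0; have := xS.2; rewrite x0 big1 => [/eqP|i _]; last by rewrite mxE.
  by rewrite eq_sym oner_eq0.
have PAE y : y *m P *m A = y *m A *m P.
  by rewrite -!mulmxA PA.
have xA : x *m A = r *: x.
  apply/eqP; rewrite -subr_eq0; apply/negPn/negP => z0.
  have zge k : 0 <= (x *m A - r *: x) ord0 k.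
    by rewrite mx_subZE subr_ge0.
  have zP := gt0P _ zge z0.
  pose y := x *m P; have y0 : forall k, 0 < y ord0 k by apply: gt0P => //; exact: xS.1.
  (* The smallest relative slack over the coordinates, capped at 1: [y] still certifies the bound
     [r + e]. *)
  pose e := \big[Num.min/1]_k ((y *m A - r *: y) ord0 k / y ord0 k).
  have e0 : 0 < e.
    rewrite /e; elim/big_ind : _ => // [a b a0 b0|k _]; first by rewrite lt_min a0.
    by rewrite divr_gt0// /y PAE scalemxAl -mulmxBl.
  have : r + e <= r.
    apply: (rmax y) => [|k|k]; [exact: rV_gt0_neq0|exact: (ltW (y0 k))|].
    have : e <= (y *m A - r *: y) ord0 k / y ord0 k by rewrite /e; exact: bigmin_le.
    rewrite ler_pdivlMr// mx_subZE mulrDl => ?; lra.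
  by rewrite gerDl leNgt e0.
(* The maximizer [x] is only known to be nonnegative; its image under [P] has the same eigenvalue
   and positive coordinates. *)
exists r, (x *m P); split => //; first by apply: gt0P => //; exact: xS.1.
by rewrite PAE xA scalemxAl.
Qed.

Lemma le_normc_sum (I : finType) (F : I -> R[i]) :
  Normc.normc (\sum_i F i) <= \sum_i Normc.normc (F i).
Proof.
elim/big_ind2 : _ => // [|a b c e ab ce]; first by rewrite Normc.normc0.
exact: (le_trans (le_normcD _ _)) (lerD ab ce).
Qed.

Lemma normc_ge0 (z : R[i]) : 0 <= Normc.normc z.
Proof. by case: z => a b; exact: sqrtr_ge0. Qed.

Lemma normc_real (a : R) : Normc.normc (real_complex R a) = `|a|.
Proof. by rewrite /= expr0n/= addr0 sqrtr_sqr. Qed.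

(** By the triangle inequality, the moduli of the coordinates of a complex eigenvector for [z]
    certify the bound [|z|], which maximality of [r] then controls. *)
Lemma spectral_radius_perron A r v : (forall i j, 0 <= A i j) -> 0 <= r ->
  v != 0 -> v *m A = r *: v ->
  (forall x l, x != 0 -> (forall k, 0 <= x ord0 k) ->
      (forall k, l * x ord0 k <= (x *m A) ord0 k) -> l <= r) ->
  spectral_radius A = r.
Proof.
move=> A0 r0 v0 vA rmax; rewrite /spectral_radius; set S := (X in sup X).
have Sr : S r.
  exists (real_complex R r); last by rewrite normc_real ger0_norm.
  apply/eigenvalueP; exists (map_mx (real_complex R) v).
    by rewrite -map_mxM vA map_mxZ.
  by rewrite map_mx_eq0.
have ubS : ubound S r.
  move=> _ [z /eigenvalueP [y yA y0] <-].
  apply: (rmax (\row_k Normc.normc (y ord0 k))) => [|k|k].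
  - move/rV0Pn : y0 => [k yk]; apply/rV0Pn; exists k; rewrite mxE.
    by apply: contra yk => /eqP/Normc.eq0_normc ->.
  - by rewrite mxE normc_ge0.
  - rewrite mxE -Normc.normcM.
    have -> : z * y ord0 k = (z *: y) ord0 k by rewrite mxE.
    rewrite -yA 2!mxE; apply: (le_trans (le_normc_sum _)); apply: ler_sum => i _.
    by rewrite !mxE Normc.normcM normc_real ger0_norm.
apply/eqP; rewrite eq_le; apply/andP; split.
  by apply: ge_sup => //; exists r.
by apply: ub_le_sup => //; exists r.
Qed.

End Perron.

Section PerronPair.
Context {R : realType} {p : nat}.
Implicit Types (A : 'M[R]_p.+1) (v : 'rV[R]_p.+1) (w y : 'cV[R]_p.+1).

Lemma trmx_exp A n : (A ^+ n)^T = A^T ^+ n.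
Proof. by elim: n => [|n IH]; rewrite ?expr0 ?trmx1// exprS trmx_mul IH exprSr. Qed.

(** The right vector is the left Perron vector of the transpose. Both eigenvalues agree because two
    positive vectors have a nonzero pairing. *)
Lemma perron A : (forall i j, 0 <= A i j) -> irreducible_mx A ->
  exists v w, [/\ forall k, 0 < v ord0 k, forall k, 0 < w k ord0,
    \sum_k w k ord0 = 1, v *m A = spectral_radius A *: v &
    A *m w = spectral_radius A *: w].
Proof.
move=> A0 irrA; have [r [v [r0 v0 vA rmax]]] := perron_row A0 irrA.
have [||s [w [s0 w0 wA _]]] := @perron_row R p A^T.
- by move=> i j; rewrite mxE.
- move=> i j; have [n nP] := irrA j i; exists n.
  by rewrite -trmx_exp mxE.
have sr : r = s.
  have vw : 0 < (v *m w^T) ord0 ord0.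
    rewrite mxE; apply: (sum_gt0 (i := ord0)) => [j|]; rewrite mxE.
      by rewrite mulr_ge0// ltW.
    by rewrite mulr_gt0.
  have Aw : A *m w^T = s *: w^T.
    by apply: trmx_inj; rewrite trmx_mul trmxK wA linearZ/= trmxK.
  have : r *: (v *m w^T) = s *: (v *m w^T).
    by rewrite scalemxAl -vA -mulmxA Aw -scalemxAr.
  move=> /matrixP /(_ ord0 ord0); rewrite [LHS]mxE [RHS]mxE.
  by move/mulIf; apply; rewrite gt_eqF.
have -> := spectral_radius_perron A0 r0 (rV_gt0_neq0 v0) vA rmax.
have S0 : 0 < \sum_k w ord0 k by apply: (sum_gt0 (i := ord0)) => // j; exact: (ltW (w0 j)).
exists v, ((\sum_k w ord0 k)^-1 *: w^T); split => //.
- by move=> k; rewrite !mxE mulr_gt0// invr_gt0.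
- under eq_bigr do rewrite !mxE.
  by rewrite -mulr_sumr mulVf// gt_eqF.
- rewrite -scalemxAr scalerA mulrC -scalerA; congr (_ *: _).
  by apply: trmx_inj; rewrite trmx_mul trmxK wA sr linearZ/= trmxK.
Qed.

(** Pair the inequality with the positive left eigenvector and divide by its pairing with [y]. *)
Lemma spectral_radius_le A l y : (forall i j, 0 <= A i j) -> irreducible_mx A ->
  (forall k, 0 < y k ord0) ->
  (forall k, (A *m y) k ord0 <= l * y k ord0) -> spectral_radius A <= l.
Proof.
move=> A0 irrA y0 Ay; have [u [_ [u0 _ _ uA _]]] := perron A0 irrA.
have uy : 0 < (u *m y) ord0 ord0.
  rewrite mxE; apply: (sum_gt0 (i := ord0)) => [j|]; last by rewrite mulr_gt0.
  by rewrite mulr_ge0// ltW.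
rewrite -(ler_pM2r uy).
have -> : spectral_radius A * (u *m y) ord0 ord0 = (u *m (A *m y)) ord0 ord0.
  by rewrite mulmxA uA -scalemxAl [RHS]mxE.
rewrite [leLHS]mxE [X in _ <= _ * X]mxE mulr_sumr ler_sum// => k _.
by rewrite mulrCA ler_wpM2l// ltW.
Qed.

(** The vector [u] of absolute values satisfies [A *m u >= r *: u] entrywise, and pairing with the
    positive left eigenvector forces equality. So [u] is an eigenvector of every power of [A]; row
    [k] of these powers has all terms zero, and irreducibility reaches every coordinate. *)
Lemma perron_eigenvector_nz A y k : (forall i j, 0 <= A i j) -> irreducible_mx A ->
  A *m y = spectral_radius A *: y -> y k ord0 = 0 -> y = 0.
Proof.
move=> A0 irrA Ay yk; have [v [_ [v0 _ _ vA _]]] := perron A0 irrA.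
set r := spectral_radius A in Ay vA *.
pose u : 'cV[R]_p.+1 := \col_i `|y i ord0|.
have Au_ge i : 0 <= (A *m u - r *: u) i ord0.
  rewrite mx_subZE subr_ge0 [u i ord0]mxE [leRHS]mxE.
  have := congr1 (fun M : 'cV__ => `|M i ord0|) Ay; rewrite /= [in RHS]mxE normrM => h.
  apply: (@le_trans _ _ (`|r| * `|y i ord0|)); first by rewrite ler_wpM2r// ler_norm.
  rewrite -h mxE; apply: (le_trans (ler_norm_sum _ _ _)); apply: ler_sum => j _.
  by rewrite normrM [in leRHS]mxE ger0_norm.
have Au : A *m u = r *: u.
  apply/eqP; rewrite -subr_eq0; apply/eqP/colP => i.
  have : (v *m (A *m u - r *: u)) ord0 ord0 = 0.
    by rewrite mulmxBr mulmxA vA -scalemxAl -scalemxAr subrr mxE.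
  rewrite mxE => /sum_ge0_eq0 h; have {h} := h _ i.
  have -> : (A *m u - r *: u) i ord0 = (A *m u - r *: u) i 0 by [].
  move=> h; rewrite [RHS]mxE; apply/eqP.
  have /eqP : v ord0 i * (A *m u - r *: u) i 0 = 0.
    by apply: h => j; rewrite mulr_ge0// ltW.
  by rewrite mulf_eq0 gt_eqF.
have Anu n : A ^+ n *m u = r ^+ n *: u.
  elim: n => [|n IH]; first by rewrite !expr0 mul1mx scale1r.
  by rewrite exprSr -mulmxA Au -scalemxAr IH scalerA exprS.
apply/colP => i; rewrite [RHS]mxE; have [n nki] := irrA k i.
have := congr1 (fun M : 'cV__ => M k ord0) (Anu n).
rewrite /= mxE [RHS]mxE [u k ord0]mxE yk normr0 mulr0 => /sum_ge0_eq0 h.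
have /eqP : (A ^+ n) k i * u i 0 = 0.
  by apply: h => j; rewrite mulr_ge0 ?expmx_ge0// mxE.
by rewrite mulf_eq0 gt_eqF//= mxE normr_eq0 => /eqP.
Qed.

(** The multiple of [w] is chosen to cancel one coordinate of [y]; what remains vanishes by
    [perron_eigenvector_nz]. *)
Lemma perron_eigenvector_uniq A w y : (forall i j, 0 <= A i j) -> irreducible_mx A ->
  (forall k, 0 < w k ord0) -> A *m w = spectral_radius A *: w ->
  A *m y = spectral_radius A *: y -> exists a, y = a *: w.
Proof.
move=> A0 irrA w0 Aw Ay; exists (y ord0 ord0 / w ord0 ord0).
apply/eqP; rewrite -subr_eq0; apply/eqP.
apply: (@perron_eigenvector_nz A _ ord0) => //.
  by rewrite mulmxBr -scalemxAr Ay Aw scalerBr !scalerA [_ * spectral_radius A]mulrC.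
by rewrite !mxE divfK ?subrr// gt_eqF.
Qed.

End PerronPair.

(** * Perturbation of the Perron eigenvalue and eigenvector *)

Section PerronPerturbation.
Context {R : realType} {p : nat} {T : Type} (F : set_system T) {FF : Filter F}.
Variables (A : 'M[R]_p.+1) (B : T -> 'M[R]_p.+1) (W : T -> 'cV[R]_p.+1).
Variables (v : 'rV[R]_p.+1) (w : 'cV[R]_p.+1).
Hypotheses (A0 : forall i j, 0 <= A i j) (irrA : irreducible_mx A).
Hypotheses (v0 : forall k, 0 < v ord0 k) (w0 : forall k, 0 < w k ord0).
Hypotheses (w1 : \sum_k w k ord0 = 1).
Hypotheses (vA : v *m A = spectral_radius A *: v) (Aw : A *m w = spectral_radius A *: w).
Hypotheses (W0 : forall x k, 0 < W x k ord0) (W1 : forall x, \sum_k W x k ord0 = 1).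
Hypothesis BW : forall x, B x *m W x = spectral_radius (B x) *: W x.
Hypothesis BA : forall i j, B x i j @[x --> F] --> A i j.

Let r := spectral_radius A.
Let s x := spectral_radius (B x).

Let vW x := \sum_i v ord0 i * W x i ord0.

Lemma cvg0_le (f g : T -> R) : (forall x, `|f x| <= g x) ->
  g x @[x --> F] --> 0 -> f x @[x --> F] --> 0.
Proof.
move=> fg g0; apply/cvgr0Pnorm_lt => e e0.
have /cvgr0Pnorm_lt /(_ e e0) := g0; apply: filterS => x; apply: le_lt_trans.
by apply: (le_trans (fg x)); exact: ler_norm.
Qed.

Lemma perturbed_vector_le1 x k : `|W x k ord0| <= 1.
Proof.
rewrite ger0_norm ?(ltW (W0 x k))// -(W1 x).
by apply: (le_sum_term (F := fun k => W x k ord0)) => j; exact: (ltW (W0 x j)).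
Qed.

(* Pairing [B x *m W x = s x *: W x] with the unperturbed left eigenvector [v]. *)
Lemma spectral_radius_diff x :
  (s x - r) * vW x = \sum_i v ord0 i * \sum_j (B x i j - A i j) * W x j ord0.
Proof.
have h : v *m (B x *m W x - A *m W x) = (s x - r) *: (v *m W x).
  by rewrite mulmxBr mulmxA (mulmxA v A) vA -mulmxA BW -scalemxAr -scalemxAl -scalerBl.
have := congr1 (fun N : 'M[R]_1 => N ord0 ord0) h.
rewrite /= [in LHS]mxE [in RHS]mxE [in RHS]mxE => <-.
apply: eq_bigr => i _; congr (_ * _).
rewrite -mulmxBl mxE; apply: eq_bigr => j _; by rewrite !mxE.
Qed.

(** Uniformity in [x] allows division by [vW x] before anything is known about the convergence of
    [W]. *)
Lemma pairing_lb : exists2 c, 0 < c & forall x, c <= vW x.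
Proof.
exists (\big[Num.min/1]_k v ord0 k) => [|x].
  by elim/big_ind : _ => // a b a0 b0; rewrite lt_min a0.
rewrite -[leLHS]mulr1 -(W1 x) mulr_sumr ler_sum// => k _.
by rewrite ler_wpM2r ?(ltW (W0 _ _))//; exact: bigmin_le.
Qed.

(** The perturbed vectors enter only through the bound 1 on their entries and the lower bound on
    [vW]. This avoids circularity, since [cvg_perron_vector] relies on this limit. *)
Lemma cvg_spectral_radius : s x @[x --> F] --> r.
Proof.
have [c c0 cW] := pairing_lb.
apply/subr_cvg0.
apply: (@cvg0_le _ (fun x => c^-1 * \sum_i v ord0 i * \sum_j `|B x i j - A i j|)).
  move=> x; rewrite -ler_pdivrMl ?invr_gt0// invrK.
  apply: (@le_trans _ _ (`|(s x - r) * vW x|)).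
    rewrite normrM mulrC ler_wpM2l// ger0_norm// (le_trans _ (cW x))// ltW//.
  rewrite spectral_radius_diff; apply: (le_trans (ler_norm_sum _ _ _)).
  apply: ler_sum => i _; rewrite normrM gtr0_norm// ler_wpM2l ?(ltW (v0 _))//.
  apply: (le_trans (ler_norm_sum _ _ _)); apply: ler_sum => j _.
  by rewrite normrM ler_piMr// perturbed_vector_le1.
have E : c^-1 * (\sum_(i < p.+1) v ord0 i * \sum_(j < p.+1) 0) = 0.
  by rewrite big1 ?mulr0 // => i _; rewrite big1 ?mulr0.
rewrite -[X in _ --> X]E; apply: cvgMl_tmp.
apply: cvg_sumR => i; apply: cvgMl_tmp; apply: cvg_sumR => j.
by rewrite -(normr0 R); apply: cvg_norm; apply/subr_cvg0; exact: BA.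
Qed.

(* [W x] is recovered as [invmx M *m (M *m W x)], where [M *m W x] tends to [w]. *)
Let M := r%:M - A + w *m const_mx 1.

(** For [u] in the kernel, with coordinate sum [t], one gets [A *m u = r *: u + t *: w]. Pairing
    with [v] gives [t = 0], simplicity of the eigenvalue makes [u] a multiple of [w], and a multiple
    of [w] with zero sum is zero. *)
Lemma bordered_unitmx : M \in unitmx.
Proof.
rewrite -unitmx_tr -row_free_unit -kermx_eq0; apply/negPn/negP => /rowV0Pn.
move=> [u' /sub_kermxP u'M u'0]; pose u := u'^T.
have Mu : M *m u = 0 by apply: trmx_inj; rewrite trmx_mul trmxK u'M trmx0.
pose t := \sum_k u k ord0.
have Mu' : A *m u = r *: u + t *: w.
  move: Mu; rewrite /M mulmxDl mulmxBl mul_scalar_mx -mulmxA.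
  have -> : (const_mx 1 : 'rV_p.+1) *m u = t%:M.
    apply/matrixP => i j; rewrite !ord1 mxE [RHS]mxE mulr1n.
    by apply: eq_bigr => k _; rewrite mxE mul1r.
  rewrite mul_mx_scalar => /eqP; rewrite addrAC subr_eq0 => /eqP <-//.
have vw : (v *m w) ord0 ord0 != 0.
  rewrite mxE gt_eqF//; apply: (sum_gt0 (i := ord0)) => [k|]; last by rewrite mulr_gt0.
  by rewrite mulr_ge0// ltW.
have t0 : t = 0.
  have := congr1 (fun N => (v *m N) ord0 ord0) Mu'.
  rewrite /= mulmxA vA mulmxDr -!scalemxAr -scalemxAl [RHS]mxE.
  rewrite -[LHS]addr0 => /addrI /esym/eqP.
  by rewrite mxE mulf_eq0 (negPf vw) orbF => /eqP.
have [a ua] : exists a, u = a *: w.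
  by apply: (perron_eigenvector_uniq A0 irrA w0 Aw); rewrite Mu' t0 scale0r addr0.
move: t0; rewrite /t ua; under eq_bigr do rewrite mxE.
rewrite -mulr_sumr w1 mulr1 => a0; move: u'0.
by rewrite -(trmxK u') -/u ua a0 scale0r trmx0 eqxx.
Qed.

Lemma cvg_perron_vector k : W x k ord0 @[x --> F] --> w k ord0.
Proof.
have MW x : M *m W x = (r - s x) *: W x + (B x - A) *m W x + w.
  rewrite /M mulmxDl mulmxBl mul_scalar_mx -mulmxA.
  have -> : (const_mx 1 : 'rV_p.+1) *m W x = 1%:M.
    apply/matrixP => i j; rewrite !ord1 mxE [RHS]mxE mulr1n -[RHS](W1 x).
    by apply: eq_bigr => l _; rewrite mxE mul1r.
  rewrite mulmx1 mulmxBl BW scalerBl -/(s x); congr (_ + _).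
  by rewrite addrA addrNK.
have Mw : M *m w = w.
  rewrite /M mulmxDl mulmxBl mul_scalar_mx -mulmxA Aw subrr add0r.
  have -> : (const_mx 1 : 'rV_p.+1) *m w = 1%:M.
    apply/matrixP => i j; rewrite !ord1 mxE [RHS]mxE mulr1n -[RHS]w1.
    by apply: eq_bigr => l _; rewrite mxE mul1r.
  by rewrite mulmx1.
have WE x : W x k ord0 = \sum_j invmx M k j *
    ((r - s x) * W x j ord0 + (\sum_l (B x j l - A j l) * W x l ord0) + w j ord0).
  rewrite -[W x in LHS](mulKmx bordered_unitmx) MW mxE; apply: eq_bigr => j _; congr (_ * _).
  rewrite 2!mxE; congr (_ + _ + _); first by rewrite mxE.
  by rewrite mxE; apply: eq_bigr => l _; rewrite !mxE.
have -> : w k ord0 = \sum_j invmx M k j * (0 + \sum_(l < p.+1) 0 + w j ord0).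
  rewrite -[w in LHS](mulKmx bordered_unitmx) Mw mxE; apply: eq_bigr => j _.
  by rewrite big1 // !add0r.
rewrite (funext WE); apply: cvg_sumR => j; apply: cvgMl_tmp; apply: cvgD; last exact: cvg_cst.
apply: cvgD.
  apply: (@cvg0_le _ (fun x => `|r - s x|)) => [x|].
    by rewrite normrM ler_piMr// perturbed_vector_le1.
  rewrite -(normr0 R) -(subrr r); apply: cvg_norm; apply: cvgB; first exact: cvg_cst.
  exact: cvg_spectral_radius.
apply: cvg_sumR => l; apply: (@cvg0_le _ (fun x => `|B x j l - A j l|)) => [x|].
  by rewrite normrM ler_piMr// perturbed_vector_le1.
by rewrite -(normr0 R); apply: cvg_norm; apply/subr_cvg0; exact: BA.
Qed.

(** The first-order perturbation formula for a simple eigenvalue: [v D w] over [v w]. The factor [a]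
    stands for the inverse of the increment of a parameter. *)
Lemma cvg_spectral_radius_quotient (a : T -> R) (D : 'M[R]_p.+1) :
  (forall i j, a x * (B x i j - A i j) @[x --> F] --> D i j) ->
  a x * (s x - r) @[x --> F] -->
    (\sum_i v ord0 i * \sum_j D i j * w j ord0) / \sum_i v ord0 i * w i ord0.
Proof.
move=> BD; have [c c0 cW] := pairing_lb.
have -> : (fun x => a x * (s x - r)) = (fun x =>
    (\sum_i v ord0 i * \sum_j (a x * (B x i j - A i j)) * W x j ord0) / vW x).
  apply/funext => x; have vW0 : vW x != 0 by rewrite gt_eqF// (lt_le_trans c0).
  apply: (mulIf vW0); rewrite divfK// -mulrA spectral_radius_diff mulr_sumr.
  apply: eq_bigr => i _; rewrite mulrCA; congr (_ * _); rewrite mulr_sumr.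
  by apply: eq_bigr => j _; rewrite mulrA.
apply: cvgM.
  apply: cvg_sumR => i; apply: cvgMl_tmp; apply: cvg_sumR => j.
  by apply: cvgM; [exact: BD|exact: cvg_perron_vector].
apply: cvgV.
  rewrite gt_eqF//; apply: (sum_gt0 (i := ord0)) => [k|]; last by rewrite mulr_gt0.
  by rewrite mulr_ge0// ltW.
by apply: cvg_sumR => i; apply: cvgMl_tmp; exact: cvg_perron_vector.
Qed.

End PerronPerturbation.

(** * Euclidean geometry *)

Section Dot.
Context {R : realType} {d : nat}.
Implicit Types (s t u : 'rV[R]_d).

Lemma dotC s t : dot s t = dot t s.
Proof. by apply: eq_bigr => i _; rewrite mulrC. Qed.

Lemma dotDl s t u : dot (s + t) u = dot s u + dot t u.
Proof. by rewrite -big_split; apply: eq_bigr => i _; rewrite mxE mulrDl. Qed.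

Lemma dotZl a s u : dot (a *: s) u = a * dot s u.
Proof. by rewrite [RHS]mulr_sumr; apply: eq_bigr => i _; rewrite mxE mulrA. Qed.

Lemma dotNl s u : dot (- s) u = - dot s u.
Proof. by rewrite -scaleN1r dotZl mulN1r. Qed.

Lemma dotDr s t u : dot u (s + t) = dot u s + dot u t.
Proof. by rewrite !(dotC u) dotDl. Qed.

Lemma dotZr a s u : dot u (a *: s) = a * dot u s.
Proof. by rewrite !(dotC u) dotZl. Qed.

Lemma dotNr s u : dot u (- s) = - dot u s.
Proof. by rewrite !(dotC u) dotNl. Qed.

Lemma dot0l u : dot 0 u = 0.
Proof. by rewrite -(scale0r u) dotZl mul0r. Qed.

Lemma dot_ge0 s : 0 <= dot s s.
Proof. by apply: sumr_ge0 => i _; rewrite -expr2 sqr_ge0. Qed.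

Lemma dot_eq0 s : dot s s = 0 -> s = 0.
Proof.
move=> h; apply/rowP => i; rewrite mxE; apply/eqP; rewrite -sqrf_eq0 expr2.
apply/eqP; apply: (sum_ge0_eq0 (F := fun i => s ord0 i * s ord0 i)) => // j.
by rewrite -expr2 sqr_ge0.
Qed.

Lemma enorm_ge0 s : 0 <= enorm s.
Proof. exact: sqrtr_ge0. Qed.

Lemma enorm_sqr s : enorm s ^+ 2 = dot s s.
Proof. by rewrite sqr_sqrtr// dot_ge0. Qed.

Lemma enorm_eq0 s : enorm s = 0 -> s = 0.
Proof. by move=> h; apply: dot_eq0; rewrite -enorm_sqr h expr0n. Qed.

Lemma enorm_gt0 s : s != 0 -> 0 < enorm s.
Proof.
by move=> s0; rewrite lt_def enorm_ge0 andbT; apply: contra s0 => /eqP/enorm_eq0 ->.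
Qed.

Lemma enorm0 : enorm (0 : 'rV[R]_d) = 0.
Proof. by rewrite /enorm dot0l sqrtr0. Qed.

Lemma enormZ a s : enorm (a *: s) = `|a| * enorm s.
Proof. by rewrite /enorm dotZl dotZr mulrA -expr2 sqrtrM ?sqr_ge0// sqrtr_sqr. Qed.

Lemma dot_esphere u : esphere u -> dot u u = 1.
Proof. by rewrite -enorm_sqr => ->; rewrite expr1n. Qed.

Lemma esphere_neq0 u : esphere u -> u != 0.
Proof.
move=> uS; apply/eqP => u0; move: uS; rewrite /esphere/= u0 enorm0 => /eqP.
by rewrite eq_sym oner_eq0.
Qed.

Lemma esphere_delta i : esphere (delta_mx ord0 i : 'rV[R]_d).
Proof.
rewrite /esphere/= /enorm /dot (bigD1 i)//= big1 => [|j ji]; rewrite !mxE/= ?eqxx.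
  by rewrite mulr1 addr0 sqrtr1.
by rewrite (negPf ji) mulr0.
Qed.

Lemma cauchy_schwarz s t : dot s t ^+ 2 <= dot s s * dot t t.
Proof.
have [->|t0] := eqVneq t 0; first by rewrite dotC !dot0l expr0n mulr0.
have tt : 0 < dot t t by rewrite -enorm_sqr exprn_gt0// enorm_gt0.
have := dot_ge0 (dot t t *: s - dot s t *: t).
rewrite !(dotDl, dotDr, dotNl, dotNr, dotZl, dotZr) (dotC t s) => h.
rewrite -subr_ge0 -(pmulr_rge0 _ tt); apply: le_trans h _.
by rewrite le_eqVlt; apply/orP; left; apply/eqP; ring.
Qed.

Lemma ler_dot s t : dot s t <= enorm s * enorm t.
Proof.
apply: le_trans (ler_norm _) _.
rewrite -(@ler_pXn2r _ 2)// ?nnegrE// ?mulr_ge0 ?enorm_ge0//.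
by rewrite exprMn !enorm_sqr real_normK ?num_real// cauchy_schwarz.
Qed.

Lemma ler_norm_dot s t : `|dot s t| <= enorm s * enorm t.
Proof.
rewrite ler_norml ler_dot andbT lerNl -dotNl.
by apply: (le_trans (ler_dot _ _)); rewrite -scaleN1r enormZ normrN normr1 mul1r.
Qed.

Lemma coord_le_enorm s i : `|s ord0 i| <= enorm s.
Proof.
rewrite -(@ler_pXn2r _ 2)// ?nnegrE ?enorm_ge0// enorm_sqr real_normK ?num_real// expr2.
by apply: (le_sum_term (F := fun i => s ord0 i * s ord0 i)) => j; rewrite -expr2 sqr_ge0.
Qed.

Lemma mx_norm_le_enorm s : `|s| <= enorm s.
Proof.
rewrite [leLHS]/Num.norm/= mx_normrE; apply: bigmax_le => [|[i j] _]; first exact: enorm_ge0.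
by rewrite /= ord1 coord_le_enorm.
Qed.

Lemma near0_enorm (P : 'rV[R]_d -> Prop) : (\forall t \near (0 : 'rV[R]_d), P t) ->
  exists2 e, 0 < e & forall t, enorm t <= e -> P t.
Proof.
move=> /nbhs_normP [e /= e0 eP]; exists (e / 2); first by rewrite divr_gt0.
move=> t te; apply: eP; rewrite /= sub0r normrN.
apply: le_lt_trans (mx_norm_le_enorm t) _; apply: le_lt_trans te _.
by rewrite ltr_pdivrMr// mulr_natr mulr2n ltrDl.
Qed.

Lemma continuous_dotl u : continuous (fun t => dot t u).
Proof.
apply: continuous_sumR => i x.
by apply: continuousM; [exact: coord_continuous|exact: cst_continuous].
Qed.

End Dot.

(** * Level sets of convex functions *)

Section Convex.
Context {R : realType} {d : nat}.
Implicit Types (s t u h : 'rV[R]_d.+1) (f : 'rV[R]_d.+1 -> R).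

Definition convexf f := forall a s t, 0 <= a -> a <= 1 ->
  f (a *: s + (1 - a) *: t) <= a * f s + (1 - a) * f t.

Lemma convexf_mean f n (x : 'I_n.+1 -> 'rV[R]_d.+1) : convexf f ->
  f (n.+1%:R^-1 *: \sum_k x k) <= n.+1%:R^-1 * \sum_k f (x k).
Proof.
move=> cf; elim: n x => [|n IH] x; first by rewrite !big_ord1 invr1 scale1r mul1r.
rewrite [X in f (_ *: X)]big_ord_recr/= [X in _ <= _ * X]big_ord_recr/=.
set S := \sum_(i < n.+1) _; set T := \sum_(i < n.+1) _.
have n1 : (n.+1%:R : R) != 0 by rewrite pnatr_eq0.
have n2 : (n.+2%:R : R) != 0 by rewrite pnatr_eq0.
pose a : R := n.+1%:R / n.+2%:R.
have a1 : 1 - a = n.+2%:R^-1.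
  by rewrite /a -[X in X - _](divff n2) -mulrBl -natrB// subSnn mul1r.
have aE : a * n.+1%:R^-1 = n.+2%:R^-1 by rewrite /a mulrAC divff// mul1r.
have -> : n.+2%:R^-1 *: (S + x ord_max) = a *: (n.+1%:R^-1 *: S) + (1 - a) *: x ord_max.
  by rewrite a1 scalerA aE scalerDr.
apply: le_trans (cf _ _ _ _ _) _.
- by rewrite divr_ge0// ler0n.
- by rewrite /a ler_pdivrMr ?ltr0n// mul1r ler_nat.
rewrite a1 mulrDr lerD2r -aE -[a / _ * T]mulrA ler_wpM2l ?divr_ge0 ?ler0n//; exact: IH.
Qed.

Lemma derivable_near f t (v : 'rV[R]_d.+1) : derivable f t v ->
  forall e : R, 0 < e ->
  \forall a \near (0 : R), `|f (t + a *: v) - f t - a * 'D_v f t| <= e * `|a|.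
Proof.
move=> ft e e0.
have /cvgrPdist_le /(_ e e0) : (fun a => a^-1 *: ((f \o shift t) (a *: v) - f t))
  @ 0^' --> 'D_v f t by exact: ft.
rewrite near_withinE; apply: filterS => a h.
have [->|a0] := eqVneq a 0.
  by rewrite scale0r addr0 subrr mul0r subr0 normr0 mulr0.
have {}h := h a0; set D := 'D_v f t in h *.
have -> : f (t + a *: v) - f t - a * D = - a * (D - a^-1 *: ((f \o shift t) (a *: v) - f t)).
  by rewrite /= [_ *: v + t]addrC /GRing.scale/=; field.
by rewrite normrM normrN mulrC ler_wpM2r.
Qed.

(* A convex function with partial derivatives is bounded along [h] by the mean of its
   values along the coordinate axes. *)
Lemma convexf_directional f t h (e : R) : convexf f ->
  (forall i, derivable f t (delta_mx ord0 i)) -> 0 < e ->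
  \forall a \near (0 : R), f (t + a *: h) <= f t + a * dot (grad f t) h + e * `|a|.
Proof.
move=> cf df e0; pose S : R := \sum_i `|h ord0 i|.
have S0 : 0 <= S by apply: sumr_ge0.
(* The averaged axis errors add up to [e' * S * |a|]; the summand 1 guards against [S = 0]. *)
pose e' : R := e / (1 + S); have e'0 : 0 < e' by rewrite divr_gt0// ltr_wpDr.
(* Averaging over the [d.+1] axes divides each step by [d.+1], so the steps are magnified by this
   factor to have mean [t + a *: h]. *)
pose b i : R := d.+1%:R * h ord0 i.
have H i : \forall a \near (0 : R),
    `|f (t + (a * b i) *: delta_mx ord0 i) - f t - (a * b i) * 'D_(delta_mx ord0 i) f t|
      <= e' * `|a * b i|.
  have := derivable_near (df i) e'0.
  have : (a * b i) @[a --> (0 : R)] --> (0 : R).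
    by rewrite -[X in _ --> X](mul0r (b i)); apply: cvgMr_tmp.
  by move=> bi P; apply: (bi _ P).
apply: (filterS _ (filter_forall (nbhs_filter (0 : R)) H)) => a {}H.
have -> : t + a *: h = d.+1%:R^-1 *: \sum_i (t + (a * b i) *: delta_mx ord0 i).
  rewrite big_split/= sumr_const card_ord -[t *+ _]scaler_nat scalerDr scalerA mulVf ?pnatr_eq0//.
  rewrite scale1r [in LHS](row_sum_delta h) !scaler_sumr; congr (_ + _).
  apply: eq_bigr => i _; rewrite !scalerA; congr (_ *: _); rewrite /b.
  by rewrite [X in _ = _ * X]mulrCA [RHS]mulrA mulVf ?pnatr_eq0// mul1r.
apply: le_trans (convexf_mean _ cf) _.
rewrite -(ler_pM2l (ltr0Sn R d)) mulrA divff ?pnatr_eq0// mul1r.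
apply: (@le_trans _ _ (\sum_i (f t + a * b i * 'D_(delta_mx ord0 i) f t + e' * `|a * b i|))).
  apply: ler_sum => i _; have := H i; rewrite ler_norml => /andP[_ ?]; lra.
rewrite !big_split/= sumr_const card_ord -[X in X + _ + _]mulr_natl !mulrDr.
apply: lerD; first apply: lerD => //.
  rewrite /dot !mulr_sumr ler_sum// => i _; rewrite /b mxE.
  by rewrite le_eqVlt; apply/orP; left; apply/eqP; ring.
rewrite -mulr_sumr.
have -> : \sum_i `|a * b i| = d.+1%:R * `|a| * S.
  rewrite /S mulr_sumr; apply: eq_bigr => i _; rewrite /b !normrM normr_nat; ring.
have -> : e' * (d.+1%:R * `|a| * S) = (d.+1%:R * `|a|) * (e' * S) by ring.
have -> : d.+1%:R * (e * `|a|) = (d.+1%:R * `|a|) * e by ring.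
apply: ler_wpM2l; first by rewrite mulr_ge0.
by rewrite /e' -mulrA ler_piMr ?(ltW e0)// mulrC ler_pdivrMr ?mul1r ?lerDr// ltr_wpDr.
Qed.

Lemma near0_symmetric (P : R -> Prop) : (\forall a \near (0 : R), P a) ->
  exists2 a, 0 < a & P a /\ P (- a) /\ a <= 1.
Proof.
move=> /nbhs_normP [e /= e0 eP]; exists (Num.min (e / 2) 1).
  by rewrite lt_min divr_gt0//=.
have H : `|Num.min (e / 2) 1| < e.
  rewrite ger0_norm ?le_min ?ler01 ?andbT ?divr_ge0// ?(ltW e0)// gt_min.
  by rewrite ltr_pdivrMr// mulr_natr mulr2n ltrDl e0.
split; [|split].
- by apply: eP; rewrite /= sub0r normrN.
- by apply: eP; rewrite /= sub0r normrN normrN.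
- by rewrite ge_min lexx orbT.
Qed.

(** The point [t] lies between [s] and the reflected point [t - a *: (s - t)], with weight
    [(1 + a)^-1] on the latter. The upper bound of [convexf_directional] at the reflected point thus
    becomes a lower bound at [s]. *)
Lemma convexf_subgradient f t s : convexf f ->
  (forall i, derivable f t (delta_mx ord0 i)) ->
  f t + dot (grad f t) (s - t) <= f s.
Proof.
move=> cf df; apply/ler_addgt0Pr => e e0.
have [a a0 [_ [aP a1]]] := near0_symmetric (convexf_directional (s - t) cf df e0).
pose c : R := (1 + a)^-1.
have a10 : 1 + a != 0 by rewrite gt_eqF// ltr_wpDl// ltW.
have c0 : 0 <= c by rewrite invr_ge0 addr_ge0// ltW.
have c1 : c <= 1 by rewrite invf_le1 ?lerDl ?ltW// ltr_wpDl// ltW.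
have ft : t = c *: (t + - a *: (s - t)) + (1 - c) *: s.
  have -> : 1 - c = c * a.
    by apply: (mulfI a10); rewrite /c mulrBr mulr1 mulrA !divff// mul1r addrC addKr.
  rewrite -scalerA -scalerDr -addrA.
  have -> : t + (- a *: (s - t) + a *: s) = (1 + a) *: t.
    by rewrite scalerBr !scaleNr opprK addrAC addNr add0r scalerDl scale1r.
  by rewrite scalerA mulVf ?scale1r.
have := cf c (t + - a *: (s - t)) s c0 c1; rewrite -ft => h.
have {h} : f t <= c * (f t + - a * dot (grad f t) (s - t) + e * `|- a|) + (1 - c) * f s.
  by apply: le_trans h _; rewrite lerD2r ler_wpM2l.
rewrite normrN gtr0_norm//.
have -> : 1 - c = c * a.
  by apply: (mulfI a10); rewrite /c mulrBr mulr1 mulrA !divff// mul1r addrC addKr.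
rewrite -mulrA -mulrDr mulrC ler_pdivlMr; last by rewrite ltr_wpDl// ltW.
move=> h; rewrite -(ler_pM2l a0); lra.
Qed.

(** The formula of [Gamma] for an arbitrary function: the unit normal to its level set. It is
    unchanged when [f] is multiplied by a positive constant, which links [rho] to [rho_tilde]. *)
Definition ngrad f t := (enorm (grad f t))^-1 *: grad f t.

(** The subgradient inequality puts the sublevel set in a half-space whose normal, the gradient, is
    a positive multiple of [u]. *)
Lemma ngrad_maximizer f t u m s : convexf f ->
  (forall i, derivable f t (delta_mx ord0 i)) -> f t = m -> ngrad f t = u -> esphere u ->
  f s <= m -> dot s u <= dot t u.
Proof.
move=> cf df ft gu uS fs; have := convexf_subgradient s cf df.
rewrite ft => h; have {h} : dot (grad f t) (s - t) <= 0 by lra.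
have g0 : grad f t != 0.
  by apply: contraNneq (esphere_neq0 uS) => g0; rewrite -gu /ngrad g0 scaler0.
have -> : grad f t = enorm (grad f t) *: u.
  by rewrite -gu /ngrad scalerA divff ?scale1r// gt_eqF// enorm_gt0.
rewrite dotZl pmulr_rle0 ?enorm_gt0// dotDr dotNr subr_le0.
by rewrite !(dotC u).
Qed.

(** The preimage of [u] is a maximizer of [dot t u] over the compact sublevel set. Its gradient is
    nonzero because [f] takes a smaller value at 0, and it points along [u] because otherwise some
    direction would keep [f] below [m] and increase the linear form. *)
Lemma ngrad_surjective f u m : convexf f -> continuous f ->
  (forall t i, derivable f t (delta_mx ord0 i)) -> f 0 < m ->
  (exists B, forall t, f t <= m -> enorm t <= B) -> esphere u ->
  exists2 t, f t = m & ngrad f t = u.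
Proof.
move=> cf cntf df f0m [B fB] uS; pose K := [set t | f t <= m].
have K0 : K 0 by exact: ltW.
have cK : compact K.
  apply: bounded_closed_compact.
    exists B; split; first exact: num_real.
    move=> M BM t /fB tB; apply: le_trans (mx_norm_le_enorm t) _.
    exact: le_trans tB (ltW BM).
  by apply: (@closed_comp _ _ f [set y | y <= m]); [move=> t _; exact: cntf|exact: closed_le].
have [||t /set_mem tK tmax] := @compact_EVT_max _ R (fun t => dot t u) K _ cK.
- by exists 0.
- by apply: continuous_subspaceT; exact: continuous_dotl.
have {}tmax s : f s <= m -> dot s u <= dot t u by move=> sK; apply: tmax; exact: mem_set.
have ftm : f t = m.
  apply/eqP; rewrite eq_le [f t <= m]tK/= leNgt; apply/negP => ftm.
  (* The step length at which the first-order change along [u], plus the error [1 * |a|], can use up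
     the gap [m - f t]. A smaller step along [u] stays in the set and increases the form. *)
  pose e := (m - f t) / (1 + `|dot (grad f t) u|).
  have G0 : 0 < 1 + `|dot (grad f t) u| by rewrite ltr_wpDr.
  have [|a a0 [fa _]] := @near0_symmetric (fun a => f (t + a *: u) <= m).
    have e1 : 0 < (1 : R) by [].
    near=> a.
    have : f (t + a *: u) <= f t + a * dot (grad f t) u + 1 * `|a|.
      by near: a; exact: (convexf_directional u cf (df t) e1).
    move/le_trans; apply.
    have : `|a| <= e.
      near: a; apply/nbhs_normP; exists e => /=.
        by rewrite /= /e divr_gt0// subr_gt0.
      by move=> y /=; rewrite sub0r normrN => /ltW.
    rewrite /e ler_pdivlMr// => h.
    have : a * dot (grad f t) u <= `|a| * `|dot (grad f t) u| by rewrite -normrM ler_norm.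
    move=> ?; lra.
  have := tmax _ fa; rewrite dotDl dotZl (dot_esphere uS) mulr1 gerDl leNgt.
  by rewrite a0.
exists t => //.
set g := grad f t.
have g0 : g != 0.
  apply/eqP => g0; have := convexf_subgradient 0 cf (df t).
  by rewrite -/g g0 dot0l addr0 ftm leNgt f0m.
have n0 : 0 < enorm g by exact: enorm_gt0.
have gE : dot g g = enorm g ^+ 2 by rewrite enorm_sqr.
set e := ngrad f t.
have ge : g = enorm g *: e by rewrite /e /ngrad scalerA divff ?scale1r// gt_eqF.
have ee : dot e e = 1.
  rewrite /e /ngrad -/g dotZl dotZr gE; field; by rewrite gt_eqF.
(* If [dot u e < 1], the direction [u - e] decreases [f] to first order and strictly increases the
   linear form. With unit vectors, the bound then forces [u = e]. *)
have ue : 1 <= dot u e.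
  rewrite leNgt; apply/negP => ue1.
  have gh : dot g (u - e) < 0.
    by rewrite ge dotZl pmulr_rlt0// dotDr dotNr ee dotC subr_lt0.
  have e0 : 0 < - dot g (u - e) / 2 by rewrite divr_gt0// oppr_gt0.
  have [a a0 [fa _]] := near0_symmetric (convexf_directional (u - e) cf (df t) e0).
  have : f (t + a *: (u - e)) <= m.
    apply: le_trans fa _; rewrite ftm gtr0_norm// -/g.
    suff : a * dot g (u - e) <= 0 by move=> ?; lra.
    by rewrite pmulr_rle0// ltW.
  move/tmax; rewrite dotDl dotZl gerDl pmulr_rle0// dotDl dotNl (dot_esphere uS) (dotC e).
  lra.
have : dot (u - e) (u - e) = 0.
  apply/eqP; rewrite eq_le dot_ge0 andbT !(dotDl, dotDr, dotNl, dotNr) ee (dot_esphere uS) (dotC e).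
  lra.
by move/dot_eq0/eqP; rewrite subr_eq0 => /eqP ->.
Unshelve. all: by end_near. Qed.

End Convex.

(** * Laplace transforms of nonnegative weights *)

Section Summation.
Context {R : realType} {X : choiceType}.
Implicit Types (f g : X -> R).

Definition fsum f : R := fine (\esum_(x in [set: X]) (f x)%:E).

(** The sign condition is part of the notion because [esum] is a supremum over finite subsets, a
    faithful sum for nonnegative families. *)
Definition summable_ge0 f : Prop :=
  (forall x, 0 <= f x) /\ (\esum_(x in [set: X]) (f x)%:E < +oo)%E.

Lemma fsumK f : summable_ge0 f -> (fsum f)%:E = \esum_(x in [set: X]) (f x)%:E.
Proof.
by move=> [f0 fS]; rewrite fineK// ge0_fin_numE// esum_ge0// => x _; rewrite lee_fin.
Qed.

Lemma fsum_ge0 f : summable_ge0 f -> 0 <= fsum f.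
Proof. by move=> [f0 _]; apply: fine_ge0; apply: esum_ge0 => x _; rewrite lee_fin. Qed.

Lemma summable_ge0_le f g : (forall x, 0 <= f x) -> (forall x, f x <= g x) ->
  summable_ge0 g -> summable_ge0 f.
Proof.
move=> f0 fg [g0 gS]; split => //; apply: le_lt_trans gS.
by apply: le_esum => x _; rewrite lee_fin.
Qed.

Lemma ler_fsum f g : (forall x, f x <= g x) -> summable_ge0 f -> summable_ge0 g ->
  fsum f <= fsum g.
Proof.
move=> fg fS gS; rewrite -lee_fin !fsumK//.
by apply: le_esum => x _; rewrite lee_fin.
Qed.

Lemma summable_ge0D f g : summable_ge0 f -> summable_ge0 g ->
  summable_ge0 (fun x => f x + g x).
Proof.
move=> fS gS; split => [x|]; first by rewrite addr_ge0 ?fS.1 ?gS.1.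
under eq_esum do rewrite EFinD.
rewrite esumD => [|x _|x _]; [|by rewrite lee_fin fS.1|by rewrite lee_fin gS.1].
by rewrite -!fsumK// -EFinD ltry.
Qed.

Lemma fsumD f g : summable_ge0 f -> summable_ge0 g ->
  fsum (fun x => f x + g x) = fsum f + fsum g.
Proof.
move=> fS gS; apply: EFin_inj; rewrite EFinD !fsumK//; last exact: summable_ge0D.
under eq_esum do rewrite EFinD.
by rewrite esumD => // x _; rewrite lee_fin ?fS.1 ?gS.1.
Qed.

Lemma le_esumZ (k : R) f : 0 <= k -> summable_ge0 f ->
  (\esum_(x in [set: X]) (k * f x)%:E <= k%:E * \esum_(x in [set: X]) (f x)%:E)%E.
Proof.
move=> k0 fS; apply: ge_ereal_sup => _ [A fA <-].
under eq_fsbigr do rewrite EFinM.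
rewrite -ge0_mule_fsumr => [|x]; last by rewrite lee_fin fS.1.
apply: lee_wpmul2l; first by rewrite lee_fin.
by apply: ereal_sup_ubound; exists A.
Qed.

Lemma summable_ge0Z (k : R) f : 0 <= k -> summable_ge0 f -> summable_ge0 (fun x => k * f x).
Proof.
move=> k0 fS; split => [x|]; first by rewrite mulr_ge0// fS.1.
by apply: (le_lt_trans (le_esumZ k0 fS)); rewrite -fsumK// -EFinM ltry.
Qed.

(** One inequality is [le_esumZ]; the other is the same inequality for [k^-1] and the family
    [k * f x]. *)
Lemma fsumZ (k : R) f : 0 <= k -> summable_ge0 f -> fsum (fun x => k * f x) = k * fsum f.
Proof.
move=> k0 fS; have le l g : 0 <= l -> summable_ge0 g -> fsum (fun x => l * g x) <= l * fsum g.
  move=> l0 gS; rewrite -lee_fin EFinM !fsumK//; last exact: summable_ge0Z.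
  exact: le_esumZ.
apply/eqP; rewrite eq_le le//=.
have [->|k1] := eqVneq k 0; first by rewrite mul0r; apply: fsum_ge0; apply: summable_ge0Z.
have kp : 0 < k by rewrite lt_def k1.
rewrite -ler_pdivlMl//.
have -> : f = (fun x => k^-1 * (k * f x)) by apply/funext => x; rewrite mulKf.
rewrite (_ : (fun x => k * (k^-1 * (k * f x))) = (fun x => k * f x)); last first.
  by apply/funext => x; rewrite mulVKf.
by apply: le; [rewrite invr_ge0|exact: summable_ge0Z].
Qed.

Lemma fsum_gt0 f x : summable_ge0 f -> 0 < f x -> 0 < fsum f.
Proof.
move=> fS fx; rewrite -lte_fin fsumK//; apply: (@lt_le_trans _ _ (f x)%:E).
  by rewrite lte_fin.
apply: esum_ge; exists [set x]; first by split.
by rewrite fsbig_set1.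
Qed.

Lemma esum_gt0 (a : X -> \bar R) : (0 < \esum_(x in [set: X]) a x)%E ->
  exists x, (0 < a x)%E.
Proof.
move=> h; apply/not_existsP => a0; move: h; apply/negP; rewrite -leNgt.
rewrite -(@esum1 R X setT (fun=> 0%E))//; apply: le_esum => x _.
by have /negP := a0 x; rewrite -leNgt.
Qed.

End Summation.

Section Exponential.
Context {R : realType}.
Implicit Types (x y z : R).

(** Average the tangent inequalities at the mean point [z]; the linear terms cancel. *)
Lemma expR_convex a x y : 0 <= a -> a <= 1 ->
  expR (a * x + (1 - a) * y) <= a * expR x + (1 - a) * expR y.
Proof.
move=> a0 a1; set z := _ + _.
have tangent u : expR z * (1 + (u - z)) <= expR u.
  have -> : expR u = expR z * expR (u - z) by rewrite -expRD addrC subrK.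
  by rewrite ler_wpM2l ?expR_ge0 ?expR_ge1Dx.
have hx := ler_wpM2l a0 (tangent x).
have a1' : 0 <= 1 - a by rewrite subr_ge0.
have hy := ler_wpM2l a1' (tangent y).
apply: le_trans (lerD hx hy).
rewrite le_eqVlt; apply/orP; left; apply/eqP; rewrite /z; ring.
Qed.

Lemma le_expR x : x <= expR x.
Proof. by apply: (le_trans _ (expR_ge1Dx x)); rewrite lerDr. Qed.

Lemma expR_sub1_le y : expR y - 1 <= y * expR y.
Proof.
have := ler_wpM2l (expR_ge0 y) (expR_ge1Dx (- y)).
rewrite -expRD subrr expR0 => ?; lra.
Qed.

Lemma expR_sub1_norm y : `|expR y - 1| <= `|y| * expR `|y|.
Proof.
rewrite ler_norml; apply/andP; split; last first.
  apply: (le_trans (expR_sub1_le y)); apply: (le_trans (ler_norm _)).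
  by rewrite normrM ler_wpM2l// ger0_norm ?expR_ge0// ler_expR ler_norm.
have h1 := expR_ge1Dx y.
have h2 : 1 <= expR `|y|.
  by apply: (le_trans _ (expR_ge1Dx _)); rewrite lerDl.
have h3 : `|y| * 1 <= `|y| * expR `|y| by rewrite ler_wpM2l.
have h4 : - y <= `|y| by rewrite -normrN ler_norm.
lra.
Qed.

Lemma expR_taylor2 z : expR z - 1 - z <= z ^+ 2 * expR `|z|.
Proof.
apply: (@le_trans _ _ (z * (expR z - 1))); first by have := expR_sub1_le z; lra.
apply: (le_trans (ler_norm _)); rewrite normrM.
apply: (@le_trans _ _ (`|z| * (`|z| * expR `|z|))).
  by rewrite ler_wpM2l// expR_sub1_norm.
by rewrite mulrA -expr2 real_normK// num_real.
Qed.

End Exponential.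

Section LaplaceEntry.
Context {R : realType} {d : nat}.
Variable w : 'rV[int]_d -> R.
Hypothesis w0 : forall x, 0 <= w x.
Hypothesis wexp : forall g : R, 0 < g -> (\esum_(x in [set: 'rV[int]_d])
  (expR (g * enorm (map_mx intr x : 'rV[R]_d)) * w x)%:E < +oo)%E.
Implicit Types (t v h : 'rV[R]_d) (x : 'rV[int]_d).

Let ix x : 'rV[R]_d := map_mx intr x.

Definition entry t : R := fsum (fun x => expR (dot t (ix x)) * w x).

(** [wexp] covers positive exponents; [|g| + 1] is positive and dominates [g]. *)
Lemma summable_moment (g : R) : summable_ge0 (fun x => expR (g * enorm (ix x)) * w x).
Proof.
apply: (@summable_ge0_le _ _ _ (fun x => expR ((`|g| + 1) * enorm (ix x)) * w x)) => [x|x|].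
- by rewrite mulr_ge0// expR_ge0.
- rewrite ler_wpM2r// ler_expR ler_wpM2r ?enorm_ge0//.
  by rewrite (le_trans (ler_norm g))// lerDl.
- by split => [x|]; [rewrite mulr_ge0// expR_ge0|apply: wexp; rewrite ltr_wpDl].
Qed.

Lemma summable_bound (f : 'rV[int]_d -> R) (k g : R) : 0 <= k -> (forall x, 0 <= f x) ->
  (forall x, f x <= k * expR (g * enorm (ix x))) -> summable_ge0 (fun x => f x * w x).
Proof.
move=> k0 f0 fk; apply: summable_ge0_le (summable_ge0Z k0 (summable_moment g)) => x.
  by rewrite mulr_ge0.
by rewrite mulrA ler_wpM2r.
Qed.

Lemma expR_dot_le t x : expR (dot t (ix x)) <= expR (enorm t * enorm (ix x)).
Proof. by rewrite ler_expR ler_dot. Qed.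

Lemma summable_entry t : summable_ge0 (fun x => expR (dot t (ix x)) * w x).
Proof.
apply: (@summable_bound _ 1 (enorm t)) => [//|x|x]; first exact: expR_ge0.
by rewrite mul1r expR_dot_le.
Qed.

Lemma entry_ge0 t : 0 <= entry t.
Proof. exact/fsum_ge0/summable_entry. Qed.

Lemma entry_gt0 t x : 0 < w x -> 0 < entry t.
Proof.
by move=> wx; apply: (fsum_gt0 (x := x)); [exact: summable_entry|rewrite mulr_gt0// expR_gt0].
Qed.

(** Joint convexity in the parameter and an additive exponent. The exponents [y] and [z] are there
    to receive logarithms of ratios of Perron coordinates. *)
Lemma entry_convex (a : R) s t (y z : R) : 0 <= a -> a <= 1 ->
  entry (a *: s + (1 - a) *: t) * expR (a * y + (1 - a) * z) <=
  a * (entry s * expR y) + (1 - a) * (entry t * expR z).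
Proof.
move=> a0 a1; have a1' : 0 <= 1 - a by rewrite subr_ge0.
set u := a *: s + _.
have e0 (b : R) : 0 <= expR b by exact: expR_ge0.
rewrite [_ * expR (_ + _)]mulrC [_ * expR y]mulrC [_ * expR z]mulrC !mulrA.
have ay0 : 0 <= a * expR y by rewrite mulr_ge0.
have az0 : 0 <= (1 - a) * expR z by rewrite mulr_ge0.
have [sS tS uS] := And3 (summable_entry s) (summable_entry t) (summable_entry u).
rewrite /entry -!fsumZ// -fsumD; [|exact: summable_ge0Z|exact: summable_ge0Z].
apply: ler_fsum => [x||]; [|exact: summable_ge0Z|by apply: summable_ge0D; exact: summable_ge0Z].
rewrite !mulrA -mulrDl ler_wpM2r// -!mulrA -!expRD.
apply: le_trans (expR_convex _ _ a0 a1); rewrite ler_expR /u dotDl !dotZl.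
rewrite le_eqVlt; apply/orP; left; apply/eqP; ring.
Qed.

Lemma entry_lipschitz t : exists2 C, 0 <= C &
  forall h, enorm h <= 1 -> `|entry (t + h) - entry t| <= enorm h * C.
Proof.
(* One unit of the exponent absorbs the linear factor through [n <= expR n], the other absorbs
   [expR |dot h x|] with [enorm h <= 1]. *)
pose g := enorm t + 2; exists (fsum (fun x => expR (g * enorm (ix x)) * w x)) => [|h h1].
  exact/fsum_ge0/summable_moment.
have [tS hS gS] := And3 (summable_entry t) (summable_entry (t + h)) (summable_moment g).
have h0 := enorm_ge0 h.
have hgS := summable_ge0Z h0 gS.
have key x : `|expR (dot (t + h) (ix x)) - expR (dot t (ix x))| <=
    enorm h * expR (g * enorm (ix x)).
  set n := enorm (ix x); have n0 : 0 <= n by exact: enorm_ge0.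
  have yn : `|dot h (ix x)| <= enorm h * n by exact: ler_norm_dot.
  have yn1 : `|dot h (ix x)| <= n by apply: (le_trans yn); rewrite ler_piMl.
  rewrite dotDl expRD -{2}[expR (dot t _)]mulr1 -mulrBr normrM ger0_norm ?expR_ge0//.
  have -> : g * n = enorm t * n + (n + n) by rewrite /g; ring.
  rewrite !expRD mulrCA; apply: ler_pM => //; first exact: expR_dot_le.
  apply: (le_trans (expR_sub1_norm _)); rewrite mulrA; apply: ler_pM => //.
  - by apply: (le_trans yn); rewrite ler_wpM2l// le_expR.
  - by rewrite ler_expR.
rewrite /entry -fsumZ// ler_distlC; apply/andP; split.
  rewrite lerBlDr -fsumD//; apply: ler_fsum => // [x|]; last exact: summable_ge0D.
  rewrite mulrA -mulrDl ler_wpM2r//; have := key x; rewrite ler_distlC => /andP[? ?]; lra.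
rewrite -fsumD//; apply: ler_fsum => // [x|]; last exact: summable_ge0D.
rewrite mulrA -mulrDl ler_wpM2r//; have := key x; rewrite ler_distlC => /andP[? ?]; lra.
Qed.

(* The positive and negative parts are summed separately because [esum] is only
   additive on nonnegative families. *)
Definition entry_deriv t v : R :=
  fsum (fun x => Num.max (dot v (ix x)) 0 * expR (dot t (ix x)) * w x) -
  fsum (fun x => Num.max (- dot v (ix x)) 0 * expR (dot t (ix x)) * w x).

Lemma entry_derivN t v : entry_deriv t (- v) = - entry_deriv t v.
Proof.
rewrite /entry_deriv opprB; congr (_ - _); congr fsum; apply/funext => x.
  by rewrite dotNl.
by rewrite dotNl opprK.
Qed.

(** The sign of [s] is fixed because [fsumZ] scales by nonnegative factors; [entry_taylor] reaches
    negative [s] by replacing [v] with [- v]. *)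
Lemma entry_taylor_ge0 t v : exists2 C, 0 <= C & forall s : R, 0 <= s -> s <= 1 ->
  `|entry (t + s *: v) - entry t - s * entry_deriv t v| <= s ^+ 2 * C.
Proof.
(* Two copies of [enorm v] absorb the square of [dot v x], the third absorbs the exponential in
   [expR_taylor2]. *)
pose g := enorm t + 3 * enorm v.
exists (fsum (fun x => expR (g * enorm (ix x)) * w x)) => [|s s0 s1].
  exact/fsum_ge0/summable_moment.
have gS := summable_moment g.
have posS u : summable_ge0 (fun x => Num.max (dot u (ix x)) 0 * expR (dot t (ix x)) * w x).
  apply: (@summable_bound _ 1 (enorm u + enorm t)) => [//|x|x].
    by apply: mulr_ge0; [rewrite le_max lexx orbT|exact: expR_ge0].
  rewrite mul1r mulrDl expRD ler_pM ?expR_ge0 ?expR_dot_le// ?le_max ?lexx ?orbT//.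
  rewrite ge_max expR_ge0 andbT; apply: le_trans (le_expR _).
  exact: ler_dot.
have pS := posS v.
have nS : summable_ge0 (fun x => Num.max (- dot v (ix x)) 0 * expR (dot t (ix x)) * w x).
  by have := posS (- v); congr summable_ge0; apply/funext => x; rewrite dotNl.
have [tS sS] := (summable_entry t, summable_entry (t + s *: v)).
have s20 : 0 <= s ^+ 2 by exact: sqr_ge0.
have [spS snS sgS] := And3 (summable_ge0Z s0 pS) (summable_ge0Z s0 nS) (summable_ge0Z s20 gS).
have maxE (y : R) : Num.max y 0 - Num.max (- y) 0 = y.
  by case: (leP y 0) => y0; case: (leP (- y) 0) => y1; lra.
set dp := fsum _ in pS *; rewrite /entry_deriv.
(* In [low] and [up] the negative part of the derivative is moved across the inequality, so that
   only nonnegative families are summed. *)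
have low x : expR (dot t (ix x)) * w x + s * (Num.max (dot v (ix x)) 0 * expR (dot t (ix x)) * w x)
    <= expR (dot (t + s *: v) (ix x)) * w x
       + s * (Num.max (- dot v (ix x)) 0 * expR (dot t (ix x)) * w x).
  rewrite !mulrA -!mulrDl ler_wpM2r//.
  set y := dot v _; have := maxE y; set yp := Num.max y 0; set yn := Num.max (- y) 0 => yE.
  rewrite dotDl dotZl expRD -/y; set E := expR (dot t _).
  have E0 : 0 <= E by exact: expR_ge0.
  have := ler_wpM2l E0 (expR_ge1Dx (s * y)); rewrite -{1}yE => ?; lra.
have up x : expR (dot (t + s *: v) (ix x)) * w x
       + s * (Num.max (- dot v (ix x)) 0 * expR (dot t (ix x)) * w x) <=
    expR (dot t (ix x)) * w x + s * (Num.max (dot v (ix x)) 0 * expR (dot t (ix x)) * w x)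
    + s ^+ 2 * (expR (g * enorm (ix x)) * w x).
  rewrite !mulrA -!mulrDl ler_wpM2r//.
  set n := enorm (ix x); have n0 : 0 <= n by exact: enorm_ge0.
  set y := dot v _; have := maxE y; set yp := Num.max y 0; set yn := Num.max (- y) 0 => yE.
  rewrite dotDl dotZl expRD -/y.
  have -> : g * n = enorm t * n + (enorm v * n + enorm v * n + enorm v * n) by rewrite /g; ring.
  rewrite expRD; have := expR_dot_le t x; set E := expR (dot t _) => EE.
  set E' := expR (enorm t * _) in EE *; set E3 := expR (_ + _).
  have E0 : 0 <= E by exact: expR_ge0.
  have yv : `|y| <= enorm v * n by exact: ler_norm_dot.
  have tay : expR (s * y) - 1 - s * y <= s ^+ 2 * E3.
    apply: (le_trans (expR_taylor2 _)); rewrite exprMn -mulrA ler_wpM2l// /E3 !expRD.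
    rewrite -real_normK ?num_real// expr2.
    apply: ler_pM => //; rewrite ?mulr_ge0 ?expR_ge0//.
      by apply: ler_pM => //; apply: (le_trans yv); exact: le_expR.
    rewrite ler_expR normrM ger0_norm//; apply: le_trans yv; by rewrite ler_piMl.
  have h1 := ler_wpM2l E0 tay.
  have h2 : E * (s ^+ 2 * E3) <= s ^+ 2 * (E' * E3).
    rewrite mulrCA ler_wpM2l// ler_wpM2r// ?expR_ge0//.
  have h3 : E * (s * y) = s * yp * E - s * yn * E by rewrite -yE; ring.
  lra.
have Low := ler_fsum low (summable_ge0D tS spS) (summable_ge0D sS snS).
have Up := ler_fsum up (summable_ge0D sS snS) (summable_ge0D (summable_ge0D tS spS) sgS).
move: Low Up; rewrite !fsumD//; try exact: summable_ge0D.
rewrite !fsumZ// -/dp /entry; move=> Low Up.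
rewrite ler_norml; apply/andP; split; last by lra.
have : 0 <= s ^+ 2 * fsum (fun x => expR (g * enorm (ix x)) * w x).
  by rewrite mulr_ge0// fsum_ge0.
lra.
Qed.

Lemma entry_taylor t v : exists2 C, 0 <= C & forall s : R, `|s| <= 1 ->
  `|entry (t + s *: v) - entry t - s * entry_deriv t v| <= s ^+ 2 * C.
Proof.
have [C C0 CP] := entry_taylor_ge0 t v; have [D D0 DP] := entry_taylor_ge0 t (- v).
exists (C + D) => [|s s1]; first by rewrite addr_ge0.
have [s0|s0] := leP 0 s.
  rewrite ger0_norm// in s1; apply: (le_trans (CP s s0 s1)).
  by rewrite ler_wpM2l ?sqr_ge0// lerDl.
rewrite ltr0_norm// in s1; have ns0 : 0 <= - s by rewrite oppr_ge0 ltW.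
have := DP _ ns0 s1; rewrite entry_derivN mulrNN sqrrN scalerN scaleNr opprK.
by move=> /le_trans; apply; rewrite ler_wpM2l ?sqr_ge0// lerDr.
Qed.

Lemma cvg_entry_quotient t v :
  s^-1 * (entry (t + s *: v) - entry t) @[s --> (0 : R)^'] --> entry_deriv t v.
Proof.
have [C C0 CP] := entry_taylor t v.
apply/cvgrPdist_le => e e0; have C1 : 0 < C + 1 by rewrite ltr_wpDl.
rewrite near_withinE; apply/nbhs_normP; exists (Num.min 1 (e / (C + 1))) => /=.
  by rewrite lt_min ltr01 divr_gt0.
move=> s; rewrite /= sub0r normrN lt_min => /andP[s1 se] s0.
have -> : entry_deriv t v - s^-1 * (entry (t + s *: v) - entry t) =
    - s^-1 * (entry (t + s *: v) - entry t - s * entry_deriv t v).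
  by field; exact: s0.
rewrite normrM normrN normfV mulrC ler_pdivrMr ?normr_gt0//.
apply: (le_trans (CP s (ltW s1))).
rewrite -real_normK ?num_real// expr2 [e * _]mulrC -mulrA ler_wpM2l//.
move: se; rewrite ltr_pdivlMr// => /ltW; apply: le_trans.
by rewrite ler_wpM2l// lerDl.
Qed.

Lemma cvg_enorm_sub t : enorm (s - t) @[s --> t] --> (0 : R).
Proof.
have -> : (0 : R) = enorm (t - t) by rewrite subrr enorm0.
suff : {for t, continuous (Num.sqrt \o (fun s => dot (s - t) (s - t)))} by [].
apply: continuous_comp; last exact: sqrt_continuous.
apply: continuous_sumR => i s.
have c : {for s, continuous (fun s : 'rV[R]_d => (s - t) ord0 i)}.
  rewrite (_ : (fun s : 'rV[R]_d => _) = (fun s : 'rV[R]_d => s ord0 i - t ord0 i)).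
    by apply: continuousB; [exact: coord_continuous|exact: cst_continuous].
  by apply/funext => s'; rewrite !mxE.
exact: continuousM.
Qed.

Lemma continuous_entry : continuous entry.
Proof.
move=> t; have [C C0 CP] := entry_lipschitz t.
have C1 : 0 < C + 1 by rewrite ltr_wpDl.
apply/(@cvgrPdist_le _ _ _ (nbhs t)) => e e0.
have m0 : 0 < Num.min 1 (e / (C + 1)) by rewrite lt_min ltr01 divr_gt0.
have /cvgr0Pnorm_lt /(_ _ m0) := cvg_enorm_sub t => H; apply: (@filterS _ (nbhs t) _ _ _ _ H) => s.
rewrite ger0_norm ?enorm_ge0// lt_min => /andP[/ltW s1 se].
have := CP _ s1; rewrite [t + _]addrC subrK distrC => /le_trans; apply.
move: se; rewrite ltr_pdivlMr// => /ltW; apply: le_trans.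
by rewrite ler_wpM2l ?enorm_ge0// lerDl.
Qed.

End LaplaceEntry.

(** * The spectral radius of the Laplace matrix *)

Section SpectralRadiusLaplace.
Context {R : realType} {d p : nat}.
Variable nu : 'I_p.+1 -> 'I_p.+1 -> 'rV[int]_d.+1 -> R.
Hypothesis nu0 : forall i j x, 0 <= nu i j x.
Hypothesis nuexp : forall i j (g : R), 0 < g -> (\esum_(x in [set: 'rV[int]_d.+1])
  (expR (g * enorm (map_mx intr x : 'rV[R]_d.+1)) * nu i j x)%:E < +oo)%E.
Hypothesis irr : forall t : 'rV[R]_d.+1, irreducible_mx (laplace nu t).

Let f (t : 'rV[R]_d.+1) := spectral_radius (laplace nu t).

Lemma laplaceE t i j : laplace nu t i j = entry (nu i j) t.
Proof. by rewrite mxE. Qed.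

Lemma laplace_ge0 t i j : 0 <= laplace nu t i j.
Proof. by rewrite laplaceE; exact: (entry_ge0 (nu0 i j) (@nuexp i j)). Qed.

Lemma perron_laplace t : exists w : 'cV[R]_p.+1, [/\ forall k, 0 < w k ord0,
  \sum_k w k ord0 = 1 & laplace nu t *m w = f t *: w].
Proof.
have [_ [w [_ w0 w1 _ Aw]]] := perron (laplace_ge0 t) (irr t).
by exists w.
Qed.

(* The geometric mean of the Perron vectors at [s] and [t] is a supersolution of the
   eigenvalue equation at [a *: s + (1 - a) *: t]. *)
Lemma spectral_radius_laplace_convex : convexf f.
Proof.
move=> a s t a0 a1; have [w [w0 _ Aw]] := perron_laplace s.
have [z [z0 _ Az]] := perron_laplace t.
pose P k := ln (w k ord0); pose Q k := ln (z k ord0).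
have PE k : expR (P k) = w k ord0 by rewrite lnK// posrE.
have QE k : expR (Q k) = z k ord0 by rewrite lnK// posrE.
pose y : 'cV[R]_p.+1 := \col_k expR (a * P k + (1 - a) * Q k).
have wE i : \sum_j entry (nu i j) s * expR (P j - P i) = f s.
  have := congr1 (fun M : 'cV__ => M i ord0) Aw; rewrite /= mxE [RHS]mxE => h.
  apply: (mulIf (lt0r_neq0 (w0 i))); rewrite -h mulr_suml; apply: eq_bigr => j _.
  by rewrite laplaceE -mulrA -PE -PE -expRD subrK.
have zE i : \sum_j entry (nu i j) t * expR (Q j - Q i) = f t.
  have := congr1 (fun M : 'cV__ => M i ord0) Az; rewrite /= mxE [RHS]mxE => h.
  apply: (mulIf (lt0r_neq0 (z0 i))); rewrite -h mulr_suml; apply: eq_bigr => j _.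
  by rewrite laplaceE -mulrA -QE -QE -expRD subrK.
apply: (@spectral_radius_le _ _ _ _ y) => [|//|k|i]; first exact: laplace_ge0.
  by rewrite mxE expR_gt0.
rewrite mxE -(wE i) -(zE i) !mulr_sumr -big_split/= mulr_suml; apply: ler_sum => j _.
have -> : y j ord0 = expR (a * (P j - P i) + (1 - a) * (Q j - Q i)) * y i ord0.
  by rewrite !mxE -expRD; congr expR; ring.
rewrite mulrA ler_wpM2r ?mxE ?expR_ge0// -/(entry _ _).
exact: (entry_convex (nu0 i j) (@nuexp i j)).
Qed.

Lemma continuous_spectral_radius_laplace : continuous f.
Proof.
move=> t; have [v [w [v0 w0 w1 vA Aw]]] := perron (laplace_ge0 t) (irr t).
have [W WP] := choice perron_laplace.
apply: (@cvg_spectral_radius _ _ _ (nbhs t) _ (laplace nu t) (laplace nu) W v) => //.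
- by move=> s; have [] := WP s.
- by move=> s; have [] := WP s.
- by move=> s; have [] := WP s.
move=> i j; rewrite laplaceE; under eq_fun do rewrite laplaceE.
exact: (continuous_entry (nu0 i j) (@nuexp i j)).
Qed.

(** The perturbation formula along [t + s *: v], with the punctured neighbourhoods of 0 as filter
    and [s^-1] as the factor [a]. *)
Lemma derivable_spectral_radius_laplace t v : derivable f t v.
Proof.
have [x [w [x0 w0 w1 xA Aw]]] := perron (laplace_ge0 t) (irr t).
have [W WP] := choice perron_laplace.
pose D := \matrix_(i, j) entry_deriv (nu i j) t v.
have E : (fun s : R => s^-1 *: ((f \o shift t) (s *: v) - f t)) =
    (fun s : R => s^-1 * (f (t + s *: v) - f t)).
  by apply/funext => s; rewrite /= [t + _]addrC.
rewrite /derivable E; apply/cvg_ex.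
exists ((\sum_i x ord0 i * \sum_j D i j * w j ord0) / \sum_i x ord0 i * w i ord0).
have BA i j : laplace nu (t + s *: v) i j @[s --> (0 : R)^'] --> laplace nu t i j.
  rewrite laplaceE (_ : (fun s : R => laplace nu (t + s *: v) i j) =
    entry (nu i j) \o (fun s : R => t + s *: v)); last first.
    by apply/funext => s; rewrite laplaceE.
  have h : {for 0, continuous (entry (nu i j) \o (fun s : R => t + s *: v))}.
    apply: continuous_comp; last exact: (continuous_entry (nu0 i j) (@nuexp i j)).
    apply: cvgD; first exact: cvg_cst.
    by apply: cvgZr_tmp; exact: cvg_id.
  have : (entry (nu i j) \o (fun s : R => t + s *: v)) @ (0 : R)^' --> entry (nu i j) (t + 0 *: v).
    by apply: cvg_trans h; apply: cvg_app; exact: cvg_within.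
  by rewrite scale0r addr0.
have BD i j : s^-1 * (laplace nu (t + s *: v) i j - laplace nu t i j) @[s --> (0 : R)^']
    --> D i j.
  rewrite [D i j]mxE (_ : (fun s : R => _) =
    (fun s => s^-1 * (entry (nu i j) (t + s *: v) - entry (nu i j) t))).
    exact: (cvg_entry_quotient (nu0 i j) (@nuexp i j)).
  by apply/funext => s; rewrite !laplaceE.
apply: (cvg_spectral_radius_quotient (W := fun s : R => W (t + s *: v))
  (laplace_ge0 t) (irr t) x0 w0 w1 xA Aw _ _ _ BA BD).
- by move=> s; have [] := WP (t + s *: v).
- by move=> s; have [] := WP (t + s *: v).
- by move=> s; have [] := WP (t + s *: v).
Qed.

End SpectralRadiusLaplace.

(** A positive eigenvector pairs nontrivially with the left Perron vector, so its eigenvalue can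
    only be the spectral radius. *)
Lemma spectral_radius_eq {R : realType} {p : nat} (A : 'M[R]_p.+1) (r : R) (w : 'cV[R]_p.+1) :
  (forall i j, 0 <= A i j) -> irreducible_mx A -> (forall k, 0 < w k ord0) ->
  A *m w = r *: w -> spectral_radius A = r.
Proof.
move=> A0 irrA w0 Aw; have [v [_ [v0 _ _ vA _]]] := perron A0 irrA.
have vw : 0 < (v *m w) ord0 ord0.
  rewrite mxE; apply: (sum_gt0 (i := ord0)) => [j|]; last by rewrite mulr_gt0.
  by rewrite mulr_ge0// ltW.
have := congr1 (fun M => M *m w) vA; rewrite -mulmxA Aw -scalemxAl -scalemxAr.
move/matrixP/(_ ord0 ord0); rewrite [LHS]mxE [RHS]mxE => /mulIf -> //.
by rewrite gt_eqF.
Qed.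

(** * From the killed walk to its Laplace matrices and the inverse of [Gamma] *)

Section KilledWalk.
Context {R : realType} {d p : nat}.
Variable c : 'rV[int]_d.+1 -> 'I_p.+1 -> 'I_p.+1 -> R.
Hypothesis c_ge0 : forall x i j, 0 <= c x i j.
Hypothesis weight_fin : forall i, (0 < total_weight c i)%E /\ (total_weight c i < +oo)%E.
Hypothesis hA : forall m : R, 1 < m -> assumptionA c (fun=> m).

Lemma fine_weight_gt0 i : 0 < fine (total_weight c i).
Proof. by have [h1 h2] := weight_fin i; rewrite fine_gt0// h1 h2. Qed.

Lemma mu_ge0 (m : R) i j x : 0 < m -> 0 <= mu c (fun=> m) i j x.
Proof. by move=> m0; rewrite /mu divr_ge0// mulr_ge0// ltW// fine_weight_gt0. Qed.

Lemma mu_tilde_ge0 i j x : 0 <= mu_tilde c i j x.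
Proof. by rewrite /mu_tilde divr_ge0// ltW// fine_weight_gt0. Qed.

Lemma mu_tilde_exp i j (g : R) : 0 < g -> (\esum_(x in [set: 'rV[int]_d.+1])
  (expR (g * enorm (map_mx intr x : 'rV[R]_d.+1)) * mu_tilde c i j x)%:E < +oo)%E.
Proof.
(* The value 2 is an arbitrary leakiness above 1; [mu_tilde] is twice the corresponding [mu]. *)
move=> g0; have h2 : (1 : R) < 2 by rewrite ltr1n.
have S : summable_ge0
    (fun x => expR (g * enorm (map_mx intr x : 'rV[R]_d.+1)) * mu c (fun=> 2) i j x).
  split; last exact: (exp_moments (hA h2)).
  by move=> x; rewrite mulr_ge0 ?expR_ge0// mu_ge0.
have [_] := summable_ge0Z (ltW (ltr0n R 2)) S; congr (_ < _)%E; apply: eq_esum => x _.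
by rewrite (@mu_tildeE _ _ _ c 2)// mulrCA.
Qed.

Lemma krw_prob_cemetery (m : R) n s : krw_prob c (fun=> m) n None (Some s) = 0%E.
Proof.
elim: n => [//|n IH] /=; apply: esum1 => -[z|] _; first by rewrite mul0e.
by rewrite IH mule0.
Qed.

(** Forgetting positions turns a path of positive probability into a chain of types with positive
    entries of [A]. The path avoids the cemetery, from which no living state is reached. *)
Lemma krw_chain (m : R) (A : 'M[R]_p.+1) : 0 < m -> (forall i j, 0 <= A i j) ->
  (forall i j x, 0 < mu c (fun=> m) i j x -> 0 < A i j) ->
  forall n x i y j, (0 < krw_prob c (fun=> m) n (Some (x, i)) (Some (y, j)))%E ->
  0 < (A ^+ n) i j.
Proof.
move=> m0 A0 Apos; elim => [|n IH] x i y j.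
  rewrite /= lte_fin ltr0n lt0b => /eqP [_ ->].
  by rewrite expr0 mxE eqxx ltr01.
move=> /esum_gt0 [[[z k]|] h].
  have s0 : 0 <= krw_step c (fun=> m) (Some (x, i)) (Some (z, k)) by exact: mu_ge0.
  have [s1|] := ltP 0 (krw_step c (fun=> m) (Some (x, i)) (Some (z, k))); last first.
    move=> s1; move: h; suff -> : krw_step c (fun=> m) (Some (x, i)) (Some (z, k)) = 0.
      by rewrite mul0e ltxx.
    by apply/eqP; rewrite eq_le s0 s1.
  rewrite exprS mxE; apply: (sum_gt0 (i := k)) => [l|].
    by rewrite mulr_ge0// expmx_ge0.
  rewrite mulr_gt0//; first exact: (Apos _ _ (z - x)).
  by apply: (IH z k y j); rewrite pmule_rgt0 ?lte_fin in h.
have : (0 < (krw_step c (fun=> m) (Some (x, i)) None)%:E *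
  krw_prob c (fun=> m) n None (Some (y, j)))%E by exact: h.
by rewrite krw_prob_cemetery mule0 ltxx.
Qed.

(** The exponential tilt is positive, so one positive weight makes the Laplace entry positive for
    every [t]; irreducibility of the walk then passes to the types. *)
Lemma irreducible_laplace (m : R) (nu : 'I_p.+1 -> 'I_p.+1 -> 'rV[int]_d.+1 -> R) t :
  1 < m -> (forall i j x, 0 <= nu i j x) ->
  (forall i j (g : R), 0 < g -> (\esum_(x in [set: 'rV[int]_d.+1])
     (expR (g * enorm (map_mx intr x : 'rV[R]_d.+1)) * nu i j x)%:E < +oo)%E) ->
  (forall i j x, 0 < mu c (fun=> m) i j x -> 0 < nu i j x) ->
  irreducible_mx (laplace nu t).
Proof.
move=> m1 nu0 nuexp nupos i j.
have [n _ h] := irreducible (hA m1) 0 i j; exists n.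
apply: (@krw_chain m _ _ _ _ n 0 i 0 j h); first exact: lt_trans m1.
  by move=> k l; rewrite laplaceE; exact: (entry_ge0 (nu0 k l) (@nuexp k l)).
by move=> k l x /nupos; rewrite laplaceE; exact: (entry_gt0 (nu0 k l) (@nuexp k l)).
Qed.

Lemma mu_tilde_irr t : irreducible_mx (laplace (mu_tilde c) t).
Proof.
have h2 : (1 : R) < 2 by rewrite ltr1n.
apply: (irreducible_laplace _ h2) => //; first exact: mu_tilde_ge0.
  exact: mu_tilde_exp.
by move=> i j x; rewrite (@mu_tildeE _ _ _ c 2)// => ?; rewrite mulr_gt0.
Qed.

Lemma rho_tilde_convex : convexf (rho_tilde c).
Proof.
exact: (spectral_radius_laplace_convex mu_tilde_ge0 mu_tilde_exp mu_tilde_irr).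
Qed.

Lemma continuous_rho_tilde : continuous (rho_tilde c).
Proof.
exact: (continuous_spectral_radius_laplace mu_tilde_ge0 mu_tilde_exp mu_tilde_irr).
Qed.

Lemma derivable_rho_tilde t v : derivable (rho_tilde c) t v.
Proof.
exact: (derivable_spectral_radius_laplace mu_tilde_ge0 mu_tilde_exp mu_tilde_irr).
Qed.

(** The two Laplace matrices differ by the factor [m^-1] and share a positive eigenvector, to which
    [spectral_radius_eq] applies. *)
Lemma rhoE (m : R) : 1 < m -> rho c (fun=> m) = m^-1 \*: rho_tilde c.
Proof.
move=> m1; have m0 : 0 < m by exact: lt_trans m1.
have mn0 : m != 0 by rewrite gt_eqF.
apply/funext => t; rewrite /rho /=.
have muexp i j (g : R) : 0 < g -> (\esum_(x in [set: 'rV[int]_d.+1])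
  (expR (g * enorm (map_mx intr x : 'rV[R]_d.+1)) * mu c (fun=> m) i j x)%:E < +oo)%E.
  exact: (exp_moments (hA m1)).
have mu0 i j x : 0 <= mu c (fun=> m) i j x by exact: mu_ge0.
have LE : laplace (mu c (fun=> m)) t = m^-1 *: laplace (mu_tilde c) t.
  apply/matrixP => i j; rewrite [RHS]mxE !laplaceE.
  rewrite -(@fsumZ _ _ m^-1) ?invr_ge0 ?(ltW m0)//.
    congr fsum; apply/funext => x.
    by rewrite (@mu_tildeE _ _ _ c m)// [RHS]mulrCA mulKf.
  exact: (summable_entry (@mu_tilde_ge0 i j) (@mu_tilde_exp i j)).
have [w [w0 _ Aw]] := perron_laplace mu_tilde_ge0 mu_tilde_exp mu_tilde_irr t.
apply: (@spectral_radius_eq _ _ _ _ w) => //.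
- by move=> i j; rewrite laplaceE; exact: (entry_ge0 (mu0 i j) (@muexp i j)).
- exact: (irreducible_laplace _ m1 mu0 muexp).
- by rewrite LE -scalemxAl Aw scalerA.
Qed.

Lemma ngrad_rho (m : R) t : 1 < m -> Gamma c (fun=> m) t = ngrad (rho_tilde c) t.
Proof.
move=> m1; have m0 : 0 < m by exact: lt_trans m1.
have gE : grad (rho c (fun=> m)) t = m^-1 *: grad (rho_tilde c) t.
  apply/rowP => i; rewrite !mxE rhoE// deriveZ//; exact: derivable_rho_tilde.
rewrite /Gamma gE enormZ ger0_norm ?invr_ge0 ?(ltW m0)// /ngrad scalerA; congr (_ *: _).
by rewrite invfM invrK mulrC mulrA mulVf ?mul1r ?gt_eqF.
Qed.

Lemma bdTE (m : R) : 1 < m -> bdT c (fun=> m) = [set t | rho_tilde c t = m].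
Proof.
move=> m1; have m0 : m != 0 by rewrite gt_eqF// (lt_trans _ m1).
apply/seteqP; split => t; rewrite /bdT /= rhoE//= => h.
  by rewrite -[LHS](mulVKf m0) [m^-1 * _]h mulr1.
by rewrite h; exact: mulVf.
Qed.

(** The partial inverse is a genuine preimage only on the image of [Gamma], so [ngrad_surjective]
    comes first; [ngrad_maximizer] then applies to the preimage selected. *)
Lemma Gamma_inv_spec (m : R) u : 1 < m -> rho_tilde c 0 = 1 ->
  (exists B, forall t, rho_tilde c t <= m -> enorm t <= B) -> esphere u ->
  rho_tilde c (Gamma_inv c (fun=> m) u) = m /\
  forall s, rho_tilde c s <= m -> dot s u <= dot (Gamma_inv c (fun=> m) u) u.
Proof.
move=> m1 r0 hB uS; have r0m : rho_tilde c 0 < m by rewrite r0.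
have surj : set_surj (bdT c (fun=> m)) esphere (Gamma c (fun=> m)).
  move=> v vS; have [t tm tv] := ngrad_surjective rho_tilde_convex continuous_rho_tilde
    (fun t i => @derivable_rho_tilde t (delta_mx ord0 i)) r0m hB vS.
  by exists t; [rewrite bdTE|rewrite ngrad_rho].
have tb : rho_tilde c (Gamma_inv c (fun=> m) u) = m.
  have : bdT c (fun=> m) (Gamma_inv c (fun=> m) u).
    by apply: (surjpinv_image_sub surj); exists u.
  by rewrite bdTE.
have tg : ngrad (rho_tilde c) (Gamma_inv c (fun=> m) u) = u.
  rewrite -(@ngrad_rho m)//; exact: (surjpK _ surj (mem_set uS)).
split => // s; apply: (ngrad_maximizer rho_tilde_convex _ tb tg uS) => i.
exact: derivable_rho_tilde.
Qed.

End KilledWalk.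

(** * Quadratic forms and the limit ellipsoid *)

Section Quad.
Context {R : realType} {d : nat}.
Implicit Types (S : 'M[R]_d) (s t u : 'rV[R]_d).

Lemma posdef_unit S : posdef S -> S \in unitmx.
Proof.
move=> Sp; rewrite -row_free_unit -kermx_eq0; apply/negPn/negP => /rowV0Pn.
move=> [v /sub_kermxP vS v0]; have := Sp _ v0.
by rewrite /quad vS dot0l ltxx.
Qed.

Lemma dot_mulmxr S s t : dot (s *m S) t = dot s (t *m S^T).
Proof.
rewrite /dot; under eq_bigr do rewrite mxE mulr_suml.
rewrite exchange_big/=; apply: eq_bigr => i _; rewrite mxE mulr_sumr.
by apply: eq_bigr => j _; rewrite mxE mulrAC -mulrA.
Qed.

Lemma quadZ S a t : quad S (a *: t) = a ^+ 2 * quad S t.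
Proof. by rewrite /quad -scalemxAl dotZl dotZr mulrA expr2. Qed.

Lemma posdef_ge0 S t : posdef S -> 0 <= quad S t.
Proof.
move=> Sp; have [->|t0] := eqVneq t 0; last exact/ltW/Sp.
by rewrite /quad mul0mx dot0l.
Qed.

Lemma quad_invE S s : S \in unitmx -> quad S (s *m invmx S) = quad (invmx S) s.
Proof. by move=> Su; rewrite /quad mulmxKV// dotC. Qed.

Lemma quad_inv_gt0 S s : posdef S -> s != 0 -> 0 < quad (invmx S) s.
Proof.
move=> Sp s0; have Su := posdef_unit Sp; rewrite -quad_invE//; apply: Sp.
by apply: contraNneq s0 => h; rewrite -(mulmxKV Su s) h mul0mx.
Qed.

(** Cauchy-Schwarz for the inner product defined by [S], between [t] and [x = s *m invmx S], whose
    pairing is [dot s t]. *)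
Lemma quad_cauchy_schwarz S s t : S^T = S -> posdef S ->
  dot s t ^+ 2 <= quad S t * quad (invmx S) s.
Proof.
move=> Ssym Sp; have Su := posdef_unit Sp.
have [->|s0] := eqVneq s 0.
  by rewrite dot0l expr0n/= /quad mul0mx dot0l mulr0.
have q0 := quad_inv_gt0 Sp s0.
rewrite -quad_invE// in q0 *; set x := s *m invmx S in q0 *.
have xS : x *m S = s by rewrite mulmxKV.
have xt : dot (t *m S) x = dot s t by rewrite dot_mulmxr Ssym xS dotC.
have := posdef_ge0 (quad S x *: t - dot s t *: x) Sp.
rewrite {1}/quad mulmxBl -!scalemxAl !(dotDl, dotDr, dotNl, dotNr, dotZl, dotZr) xt xS.
have -> : dot s x = quad S x by rewrite /quad xS.
rewrite -/(quad S t) => h; rewrite -subr_ge0 -(pmulr_rge0 _ q0); apply: le_trans h _.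
by rewrite le_eqVlt; apply/orP; left; apply/eqP; ring.
Qed.

Lemma quad_le S : exists2 K, 0 < K & forall t, quad S t <= K * dot t t.
Proof.
exists (1 + \sum_i \sum_j `|S j i|) => [|t].
  by rewrite ltr_pwDl// sumr_ge0// => i _; rewrite sumr_ge0.
apply: (@le_trans _ _ ((\sum_i \sum_j `|S j i|) * dot t t)); last first.
  by rewrite ler_wpM2r ?dot_ge0// lerDr.
rewrite /quad {1}/dot mulr_suml; apply: ler_sum => i _.
rewrite mxE !mulr_suml; apply: ler_sum => j _.
apply: (le_trans (ler_norm _)); rewrite !normrM mulrAC mulrC ler_wpM2l//.
by rewrite -enorm_sqr expr2 ler_pM// coord_le_enorm.
Qed.

(** Take [s = t] in [quad_cauchy_schwarz], bound the inverse form by [K * dot t t], and cancel one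
    factor [dot t t]. *)
Lemma posdef_coercive S : S^T = S -> posdef S ->
  exists2 K, 0 < K & forall t, dot t t <= K * quad S t.
Proof.
move=> Ssym Sp; have [K K0 KP] := quad_le (invmx S); exists K => // t.
have [->|t0] := eqVneq t 0; first by rewrite dot0l mulr_ge0 ?(ltW K0)// posdef_ge0.
have tt : 0 < dot t t by rewrite -enorm_sqr exprn_gt0// enorm_gt0.
rewrite -(ler_pM2r tt) -expr2; apply: (le_trans (quad_cauchy_schwarz t t Ssym Sp)).
by rewrite -mulrA mulrCA ler_wpM2l ?KP// posdef_ge0.
Qed.

Lemma quad_inv_sphere_lb S : S^T = S -> posdef S ->
  exists2 K, 0 < K & forall u, esphere u -> 1 <= K * quad (invmx S) u.
Proof.
move=> Ssym Sp; have [K K0 KP] := quad_le S; exists K => // u uS.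
have := quad_cauchy_schwarz u u Ssym Sp; rewrite (dot_esphere uS) expr1n => /le_trans; apply.
have := KP u; rewrite (dot_esphere uS) mulr1 => h; rewrite ler_wpM2r//.
by rewrite ltW// quad_inv_gt0// esphere_neq0.
Qed.

End Quad.

(** * Small sublevel sets and their support functions *)

Section Asymptotics.
Context {R : realType} {d : nat}.
Variables (f : 'rV[R]_d.+1 -> R) (S : 'M[R]_d.+1).
Hypotheses (cf : convexf f) (Ssym : S^T = S) (Sp : posdef S).
Hypothesis f_exp : (fun t : 'rV[R]_d.+1 => f t - (1 + 2^-1 * quad S t))
     =o_ (0 : 'rV[R]_d.+1) (fun t : 'rV[R]_d.+1 => enorm t ^+ 2).

(** Coercivity makes the error relative: an error of [e / (2 * K)] times [dot t t] is at most [e]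
    times half the quadratic form. *)
Lemma expansion_near (e : R) : 0 < e -> exists2 r, 0 < r & forall t, enorm t <= r ->
  (1 - e) * (2^-1 * quad S t) <= f t - 1 <= (1 + e) * (2^-1 * quad S t).
Proof.
move=> e0; have [K K0 KP] := posdef_coercive Ssym Sp.
have k0 : 0 < e / (2 * K) by rewrite divr_gt0// mulr_gt0.
have /eqoP /(_ _ k0) /near0_enorm [r r0 rP] := f_exp.
exists r => // t /rP; rewrite [X in _ <= _ * X]ger0_norm ?sqr_ge0// enorm_sqr => h.
have {h} : `|f t - (1 + 2^-1 * quad S t)| <= e * (2^-1 * quad S t).
  apply: (le_trans h); apply: (@le_trans _ _ (e / (2 * K) * (K * quad S t))).
    by rewrite ler_wpM2l ?(ltW k0).
  by rewrite le_eqVlt; apply/orP; left; apply/eqP; field; rewrite gt_eqF.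
rewrite ler_norml => /andP[? ?]; apply/andP; split; lra.
Qed.

Lemma expansion_at0 : f 0 = 1.
Proof.
have [r r0 /(_ 0)] := expansion_near ltr01.
rewrite enorm0 (ltW r0) /quad mul0mx dot0l !mulr0 => /(_ isT).
by move=> h; apply/eqP; rewrite -subr_eq0 eq_le andbC.
Qed.

(** Convexity on the segment from 0 to [t]: an excess of [k] over [f 0 = 1] at norm [r] grows at
    least linearly beyond. *)
Lemma convexf_outside (k r : R) t : 0 < r -> (forall s, enorm s = r -> 1 + k <= f s) ->
  r < enorm t -> k * enorm t <= r * (f t - 1).
Proof.
move=> r0 fk rt; have t0 : 0 < enorm t by exact: lt_trans rt.
have a0 : 0 <= r / enorm t by rewrite divr_ge0// ltW.
have a1 : r / enorm t <= 1 by rewrite ler_pdivrMr// mul1r ltW.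
have := cf t 0 a0 a1; rewrite scaler0 addr0 expansion_at0.
have : 1 + k <= f ((r / enorm t) *: t).
  by apply: fk; rewrite enormZ ger0_norm// divfK// gt_eqF.
move=> h1 h2; have : k <= (r / enorm t) * (f t - 1) by lra.
by rewrite mulrAC ler_pdivlMr.
Qed.

(** Boundedness of every sublevel set gives the compactness behind [Gamma_inv_spec]; confinement of
    the low ones to the ball of radius [r] makes the local expansion valid on all of them. *)
Lemma sublevel_local (e : R) : 0 < e -> e < 1 -> exists2 r, 0 < r &
  [/\ (forall t, enorm t <= r ->
        (1 - e) * (2^-1 * quad S t) <= f t - 1 <= (1 + e) * (2^-1 * quad S t)),
      (forall m, exists B, forall t, f t <= m -> enorm t <= B) &
      exists2 k, 0 < k & forall m t, m < 1 + k -> f t <= m -> enorm t <= r].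
Proof.
move=> e0 e1; have [r r0 rP] := expansion_near e0; exists r => //.
have [K K0 KP] := posdef_coercive Ssym Sp.
(* The lower bound of [f - 1] on the sphere of radius [r], from the expansion and coercivity. *)
pose k := (1 - e) / (2 * K) * r ^+ 2.
have k0 : 0 < k by rewrite mulr_gt0 ?exprn_gt0// divr_gt0 ?subr_gt0// mulr_gt0.
have fk s : enorm s = r -> 1 + k <= f s.
  move=> sr; have := rP s; rewrite sr lexx => /(_ isT) /andP[h _].
  rewrite -lerBrDl; apply: le_trans h; rewrite /k -sr enorm_sqr -mulrA.
  apply: ler_wpM2l; first by rewrite subr_ge0 ltW.
  rewrite invfM -mulrA ler_wpM2l ?invr_ge0// mulrC ler_pdivrMr// mulrC; exact: KP.
have far := convexf_outside r0 fk.
split => //.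
  move=> m; exists (Num.max r (r * (m - 1) / k)) => t ft; rewrite le_max.
  have [//|rt/=] := leP (enorm t) r; rewrite ler_pdivlMr// mulrC.
  apply: (le_trans (far _ rt)); rewrite ler_wpM2l ?(ltW r0)//; lra.
exists k => // m t mk ft; rewrite leNgt; apply/negP => rt.
have := far _ rt; rewrite leNgt => /negP; apply.
apply: (@lt_trans _ _ (r * k)); first by rewrite ltr_pM2l//; lra.
by rewrite mulrC ltr_pM2l.
Qed.

Definition ellipsoid_radius (u : 'rV[R]_d.+1) : R := (Num.sqrt (2 * quad (invmx S) u))^-1.

(** Here [h] is the support function. It is bounded below by testing the maximizer of [dot s u] on
    the inner ellipsoid, and above by Cauchy-Schwarz at the actual maximizer [t]. *)
Lemma support_asymptotics (e : R) : 0 < e -> e < 1 -> exists2 k, 0 < k &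
  forall m h u, 1 < m -> m < 1 + k -> esphere u ->
  (exists2 t, f t = m & h = dot t u) -> (forall s, f s <= m -> dot s u <= h) ->
  (1 - e) * ellipsoid_radius u <= Num.sqrt (m - 1) / h <= (1 + e) * ellipsoid_radius u.
Proof.
move=> e0 e1; have [r r0 [rP _ [k0 k00 kP]]] := sublevel_local e0 e1.
have [K K0 KP] := posdef_coercive Ssym Sp.
(* The bound [k0] keeps [t] in the ball where the expansion holds; the other term keeps the test
   point [x] there. *)
exists (Num.min k0 (r ^+ 2 / (2 * K))).
  by rewrite lt_min k00 divr_gt0 ?exprn_gt0// mulr_gt0.
move=> m h u m1 mk uS [t ft ht] hmax.
have m10 : 0 < m - 1 by rewrite subr_gt0.
have Su := posdef_unit Sp.
pose Q := quad (invmx S) u; have Q0 : 0 < Q by rewrite quad_inv_gt0// esphere_neq0.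
have [mk1 mk2] : m < 1 + k0 /\ m - 1 <= r ^+ 2 / (2 * K).
  move: mk; rewrite -ltrBlDl lt_min => /andP[? /ltW ?]; split => //; lra.
have e10 : 0 < 1 + e by lra.
have e10' : 0 < 1 - e by lra.
(* Scaled so that the upper bound of the expansion at [x] is exactly [m - 1]. *)
pose a := Num.sqrt (2 * (m - 1) / ((1 + e) * Q)).
have a2 : a ^+ 2 = 2 * (m - 1) / ((1 + e) * Q).
  by rewrite sqr_sqrtr// divr_ge0// mulr_ge0// ltW.
have a0 : 0 < a by rewrite sqrtr_gt0 divr_gt0// mulr_gt0.
pose x := a *: (u *m invmx S).
have qx : quad S x = 2 * (m - 1) / (1 + e).
  rewrite quadZ quad_invE// a2 -/Q; field; by rewrite !gt_eqF.
have xr : enorm x <= r.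
  rewrite -(@ler_pXn2r _ 2)// ?nnegrE ?enorm_ge0 ?(ltW r0)// enorm_sqr.
  apply: (le_trans (KP x)); rewrite qx; move: mk2; rewrite ler_pdivlMr ?mulr_gt0// => mk2.
  rewrite mulrA ler_pdivrMr//; apply: (@le_trans _ _ (r ^+ 2)); first by lra.
  by rewrite ler_peMr ?sqr_ge0//; lra.
have fx : f x <= m.
  have /andP[_] := rP x xr; rewrite qx.
  have -> : (1 + e) * (2^-1 * (2 * (m - 1) / (1 + e))) = m - 1 by field; rewrite gt_eqF.
  by lra.
have hl : a * Q <= h.
  apply: le_trans (hmax x fx); rewrite dotZl ler_wpM2l ?(ltW a0)//.
have h0 : 0 < h by apply: lt_le_trans hl; rewrite mulr_gt0.
have hl2 : 2 * (m - 1) * Q <= (1 + e) * h ^+ 2.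
  apply: (@le_trans _ _ ((1 + e) * (a * Q) ^+ 2)).
    rewrite exprMn a2 le_eqVlt; apply/orP; left; apply/eqP; field; by rewrite !gt_eqF.
  by rewrite ler_wpM2l ?(ltW e10)// ler_pXn2r// nnegrE ltW// mulr_gt0.
have hu2 : (1 - e) * h ^+ 2 <= 2 * (m - 1) * Q.
  have tr : enorm t <= r by apply: (kP m) => //; rewrite ft.
  have /andP[tq _] := rP t tr; rewrite ft in tq.
  have := quad_cauchy_schwarz u t Ssym Sp; rewrite dotC -ht -/Q => hq.
  apply: (@le_trans _ _ ((1 - e) * (quad S t * Q))); first by rewrite ler_wpM2l// ltW.
  by rewrite mulrA ler_wpM2r ?(ltW Q0)//; lra.
have F0 : 0 <= Num.sqrt (m - 1) / h by rewrite divr_ge0 ?sqrtr_ge0// ltW.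
have F2 : (Num.sqrt (m - 1) / h) ^+ 2 = (m - 1) / h ^+ 2.
  by rewrite expr_div_n sqr_sqrtr// ltW.
have G0 : 0 <= ellipsoid_radius u by rewrite invr_ge0 sqrtr_ge0.
have G2 : ellipsoid_radius u ^+ 2 = (2 * Q)^-1.
  by rewrite exprVn sqr_sqrtr// mulr_ge0// ltW.
have h20 : 0 < h ^+ 2 by rewrite exprn_gt0.
have Q20 : 0 < 2 * Q by rewrite mulr_gt0.
(* After squaring, [(1 - e) ^+ 2 <= 1 - e] and [1 + e <= (1 + e) ^+ 2] absorb the square roots of
   the error factors. *)
apply/andP; split; rewrite -(@ler_pXn2r _ 2)// ?nnegrE ?mulr_ge0 ?(ltW e10) ?(ltW e10')//.
  rewrite exprMn G2 F2 ler_pdivlMr// mulrAC ler_pdivrMr//.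
  apply: (@le_trans _ _ ((1 - e) * h ^+ 2)); last by lra.
  by rewrite ler_wpM2r ?(ltW h20)// expr2 ler_piMr; lra.
rewrite F2 exprMn G2 ler_pdivrMr// mulrAC ler_pdivlMr//.
apply: (@le_trans _ _ ((1 + e) * h ^+ 2)); first by lra.
by rewrite ler_wpM2r ?(ltW h20)// expr2 ler_peMr; lra.
Qed.

Lemma ellipsoid_radius_bounded : exists2 C, 0 < C &
  forall u, esphere u -> 0 <= ellipsoid_radius u <= C.
Proof.
(* The squared radius is at most [K / 2], which is below [(K + 1) ^+ 2]. *)
have [K K0 KP] := quad_inv_sphere_lb Ssym Sp; exists (K + 1) => [|u uS].
  by rewrite ltr_wpDl// ltW.
have Q0 : 0 < quad (invmx S) u by rewrite quad_inv_gt0// esphere_neq0.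
rewrite invr_ge0 sqrtr_ge0/= -(@ler_pXn2r _ 2)// ?nnegrE ?invr_ge0 ?sqrtr_ge0//.
  rewrite exprVn sqr_sqrtr ?mulr_ge0 ?(ltW Q0)// -div1r ler_pdivrMr ?mulr_gt0//.
  by have := KP u uS => h; nra.
by rewrite addr_ge0// ltW.
Qed.

Lemma ellipsoidE : ellipsoid S = polar_region ellipsoid_radius.
Proof.
have Qpos (u : 'rV[R]_d.+1) : esphere u -> 0 < 2 * quad (invmx S) u.
  by move=> uS; rewrite mulr_gt0// quad_inv_gt0// esphere_neq0.
have key u r : esphere u -> 0 <= r ->
    (2 * quad (invmx S) (r *: u) <= 1) = (r <= ellipsoid_radius u).
  move=> uS r0; have Q0 := Qpos u uS.
  rewrite quadZ -[RHS](@ler_pXn2r _ 2)// ?nnegrE ?invr_ge0 ?sqrtr_ge0//.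
  rewrite exprVn sqr_sqrtr ?(ltW Q0)// -div1r ler_pdivlMr//.
  by congr (_ <= _); ring.
apply/seteqP; split => [s sE|_ [u [r [uS r0 rG ->]]]]; last by rewrite /ellipsoid/= key.
have [s0|s0] := eqVneq s 0.
  (* The origin has no direction of its own; any unit vector serves with radius 0. *)
  exists (delta_mx ord0 ord0), 0; split; rewrite ?scale0r//; first exact: esphere_delta.
  by rewrite invr_ge0 sqrtr_ge0.
have n0 := enorm_gt0 s0.
have uS : esphere ((enorm s)^-1 *: s).
  by rewrite /esphere/= enormZ ger0_norm ?invr_ge0 ?(ltW n0)// mulVf// gt_eqF.
have sE' : s = enorm s *: ((enorm s)^-1 *: s).
  by rewrite scalerA divff ?scale1r// gt_eqF.
exists ((enorm s)^-1 *: s), (enorm s); split => //; first exact: ltW.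
by rewrite -key// -?sE'// ltW.
Qed.

End Asymptotics.

(** * Hausdorff distance between polar regions *)

Section Distances.
Context {R : realType} {d : nat}.
Implicit Types (F G : 'rV[R]_d -> R) (A B : set 'rV[R]_d).

Lemma excess_le A B (e : R) :
  (forall a, A a -> exists2 b, B b & enorm (a - b) <= e) -> (excess A B <= e%:E)%E.
Proof.
move=> AB; apply: ge_ereal_sup => _ [a Aa <-]; have [b Bb ab] := AB a Aa.
apply: (@le_trans _ _ (enorm (a - b))%:E); last by rewrite lee_fin.
by apply: ereal_inf_lbound; exists b.
Qed.

Lemma excess_ge0 A B : A !=set0 -> (0 <= excess A B)%E.
Proof.
move=> [a Aa]; apply: (@le_trans _ _ (ereal_inf [set (enorm (a - b))%:E | b in B])).
  by apply: le_ereal_inf_tmp => _ [b Bb <-]; rewrite lee_fin enorm_ge0.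
by apply: ereal_sup_ubound; exists a.
Qed.

(** A point is moved along its own ray, by truncating its radius at [G u]; the displacement is at
    most the difference of the radii. *)
Lemma excess_polar_region F G (e : R) :
  (forall u, esphere u -> 0 <= G u /\ `|F u - G u| <= e) ->
  (excess (polar_region F) (polar_region G) <= e%:E)%E.
Proof.
move=> FG; apply: excess_le => _ [u [r [uS r0 rF ->]]]; have [G0 FGe] := FG u uS.
exists (Num.min r (G u) *: u).
  exists u, (Num.min r (G u)); split => //; first by rewrite le_min r0.
  by rewrite ge_min lexx orbT.
rewrite -scalerBl enormZ uS mulr1.
move: FGe; rewrite ler_norml => /andP[? ?]; have e0 : 0 <= e by lra.
case: (leP r (G u)) => rG; first by rewrite subrr normr0.
by rewrite ger0_norm; lra.
Qed.

End Distances.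

Lemma cvge0_squeeze {R : realType} {T : Type} (F : set_system T) {FF : Filter F}
    (g : T -> \bar R) :
  (forall e : R, 0 < e -> \forall x \near F, (0 <= g x <= e%:E)%E) ->
  g x @[x --> F] --> (0 : R)%:E.
Proof.
move=> H; apply/fine_cvgP; split.
  apply: filterS (H 1 ltr01) => x /andP[g0 g1].
  by rewrite ge0_fin_numE// (le_lt_trans g1)// ltry.
apply/cvgr0Pnorm_lt => e e0.
have e20 : 0 < e / 2 by rewrite divr_gt0.
apply: filterS (H _ e20) => x /andP[g0 ge] /=.
have gfin : g x \is a fin_num by rewrite ge0_fin_numE// (le_lt_trans ge)// ltry.
rewrite ger0_norm ?fine_ge0//; apply: (@le_lt_trans _ _ (e / 2)).
  by rewrite -lee_fin fineK.
by rewrite ltr_pdivrMr// mulr_natr mulr2n ltrDl.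
Qed.

(** * Uniform convergence of the scaled radius and of the region *)

Lemma scaled_radius_cvg {R : realType} {d p : nat}
  (c : 'rV[int]_d.+1 -> 'I_p.+1 -> 'I_p.+1 -> R) (sigma : 'M[R]_d.+1) (eta : R) :
  (forall x i j, 0 <= c x i j) ->
  (forall i, (0 < total_weight c i)%E /\ (total_weight c i < +oo)%E) ->
  (forall m : R, 1 < m -> assumptionA c (fun=> m)) ->
  sigma^T = sigma -> posdef sigma ->
  (fun t : 'rV[R]_d.+1 => rho_tilde c t - (1 + 2^-1 * quad sigma t))
     =o_ (0 : 'rV[R]_d.+1) (fun t : 'rV[R]_d.+1 => enorm t ^+ 2) ->
  0 < eta -> \forall m \near (1 : R)^'+, forall u, esphere u ->
    0 <= scaled_radius c m u /\ `|scaled_radius c m u - ellipsoid_radius sigma u| <= eta.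
Proof.
move=> c0 wf hA ssym spos sexp eta0.
have cf := rho_tilde_convex c0 wf hA.
have [C C0 CP] := ellipsoid_radius_bounded ssym spos.
(* The bound [2^-1] ensures [e < 1]; the other converts a relative error into an absolute one, since
   the limit radius is at most [C]. *)
pose e := Num.min 2^-1 (eta / C).
have e0 : 0 < e by rewrite lt_min invr_gt0 ltr0n divr_gt0.
have e1 : e < 1 by rewrite gt_min invf_lt1// ltr1n.
have eC : e * C <= eta by rewrite -ler_pdivlMr// ge_min lexx orbT.
have [k k0 kP] := support_asymptotics cf ssym spos sexp e0 e1.
have [r _ [_ bnd _]] := sublevel_local cf ssym spos sexp e0 e1.
near=> m => u uS.
have m1 : 1 < m by near: m; exact: nbhs_right_gt.
have mk : m < 1 + k by near: m; apply: nbhs_right_lt; rewrite ltrDl.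
have [tm tmax] := Gamma_inv_spec c0 wf hA m1 (expansion_at0 ssym spos sexp) (bnd m) uS.
have /andP[lo hi] := kP m _ u m1 mk uS (ex_intro2 _ _ _ tm erefl) tmax.
have /andP[G0 GC] := CP u uS.
have eG : e * ellipsoid_radius sigma u <= eta.
  by apply: le_trans eC; rewrite ler_wpM2l// ltW.
split; first by apply: le_trans lo; rewrite mulr_ge0// subr_ge0 ltW.
rewrite /scaled_radius ler_norml; apply/andP; split; lra.
Unshelve. all: by end_near. Qed.

Theorem theorem3 (R : realType) (d p : nat) (d_gt0 : (0 < d)%N) (p_gt0 : (0 < p)%N)
  (c : 'rV[int]_d -> 'I_p -> 'I_p -> R)
  (c_ge0 : forall x i j, 0 <= c x i j)
  (weight_fin : forall i, (0 < total_weight c i)%E /\ (total_weight c i < +oo)%E)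
  (hA : forall m : R, 1 < m -> assumptionA c (fun=> m))
  (zero_drift : grad (rho_tilde c) 0 = 0)
  (sigma : 'M[R]_d)
  (sigma_sym : sigma^T = sigma)
  (sigma_pos : posdef sigma)
  (sigma_exp : (fun t : 'rV[R]_d => rho_tilde c t - (1 + 2^-1 * quad sigma t))
     =o_ (0 : 'rV[R]_d) (fun t : 'rV[R]_d => enorm t ^+ 2)) :
  ereal_sup [set (`| scaled_radius c m u
                     - (Num.sqrt (2 * quad (invmx sigma) u))^-1 |)%:E
            | u in esphere] @[m --> (1 : R)^'+] --> (0 : R)%:E
  /\
  hausdorff_dist (polar_region (scaled_radius c m)) (ellipsoid sigma)
    @[m --> (1 : R)^'+] --> (0 : R)%:E.
Proof.
case: d d_gt0 c c_ge0 weight_fin hA zero_drift sigma sigma_sym sigma_pos sigma_exp => // d _.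
case: p p_gt0 => // p _ c c_ge0 weight_fin hA _ sigma sigma_sym sigma_pos sigma_exp.
have near_radius e : 0 < e -> _ :=
  @scaled_radius_cvg _ _ _ c sigma e c_ge0 weight_fin hA sigma_sym sigma_pos sigma_exp.
have [C _ CP] := ellipsoid_radius_bounded sigma_sym sigma_pos.
have G0 u : esphere u -> 0 <= ellipsoid_radius sigma u by move=> /CP /andP[].
(* A fixed direction, so that the supremum is over a nonempty set and hence nonnegative, and so that
   the ellipsoid has the origin as a witness of nonemptiness. *)
have u0S := @esphere_delta R d.+1 ord0; set u0 := delta_mx _ _ in u0S.
split; apply: cvge0_squeeze => e e0; have := near_radius e e0; apply: filterS => m radius.
  apply/andP; split; last first.
    by apply: ge_ereal_sup => _ [u uS <-]; rewrite lee_fin; have [] := radius u uS.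
  apply: (@le_trans _ _ (`|scaled_radius c m u0 - ellipsoid_radius sigma u0|)%:E).
    by rewrite lee_fin.
  by apply: ereal_sup_ubound; exists u0.
rewrite /hausdorff_dist ellipsoidE//; apply/andP; split.
  rewrite le_max; apply/orP; right; apply: excess_ge0.
  by exists 0, u0, 0; split => //; [exact: G0|rewrite scale0r].
rewrite ge_max; apply/andP; split; apply: excess_polar_region => u uS.
  by have [_ ?] := radius u uS; split => //; exact: G0.
by have [? ?] := radius u uS; split => //; rewrite distrC.
Qed.
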